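(* Let $K$ be an imaginary quadratic field of class number one with ring of integers $\mathcal{O}$, let $\ell$ be a rational prime that splits in $\mathcal{O}$ as $\ell=\lambda\bar\lambda$, and let $\mathfrak{a}$ be a fixed ideal of $\mathcal{O}$ that is prime to $(\ell)$. Then mod $\ell$ there are only finitely many Hecke eigenvalue systems with fixed level $\mathfrak{a}$: the set of Hecke eigenvalue systems occurring in $H^1(\Gamma_1(\mathfrak{a}),E)$, for fixed $\mathfrak{a}$ and varying $E$, where $E$ is a rational (that is, defined over $\mathbb{F}_\ell$) finite dimensional $\mathbb{F}_\ell[\mathrm{GL}_2(\mathcal{O}/(\ell))]$-module, is finite.
   Context: $\Gamma=\Gamma_1(\mathfrak{a})=\{\begin{pmatrix} a&b\\c&d\end{pmatrix}\in \mathrm{SL}_2(\mathcal{O}) : c\equiv d-1\equiv 0 \bmod \mathfrak{a}\}$. Let $\mathrm{M}_2(\mathcal{O})$ be the semigroup of matrices in $\mathrm{GL}_2(K)$ with entries in $\mathcal{O}$. Coefficient modules: modules are right modules, and Hecke operators are defined for coefficients that are right $\mathrm{M}_2(\mathcal{O})$-modules. $\Gamma$ acts on $E$ through reduction modulo $(\ell)$, and $E$ is regarded as an $\mathrm{M}_2(\mathcal{O})$-module. On the irreducible modules the $\mathrm{M}_2(\mathcal{O})$-action is as follows. The absolutely irreducible $\mathbb{F}_\ell[\mathrm{GL}_2(\mathcal{O}/(\ell))]$-modules are $E^{a,b}_{r,s}=(\det^a\otimes \mathrm{Sym}_r)\otimes(\det^b\otimes \mathrm{Sym}_s)$ with $0\le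 r,s\le\ell-1$, $0\le a,b\le\ell-2$, where $\mathrm{Sym}_k$ is the space of homogeneous polynomials $P(X,Y)$ of degree $k$ over $\mathbb{F}_\ell$ with $(P\cdot\begin{pmatrix} a&b\\c&d\end{pmatrix})(X,Y)=P(aX+bY,cX+dY)$. All of $\mathrm{M}_2(\mathcal{O})$ acts on the first tensor factor through reduction modulo $\lambda$ and on the second through reduction modulo $\bar\lambda$. Hecke operators: let $\pi$ be any prime element of $\mathcal{O}$ (primes dividing $\ell$ are included). Put $\tilde\pi=\begin{pmatrix}\pi&0\\0&1\end{pmatrix}$ and write $\Gamma\tilde\pi\Gamma=\bigsqcup_{i=1}^m\gamma_i\Gamma$. For $g\in\Gamma$ and each $i$ there is a unique $j(i)$ with $\gamma_{j(i)}^{-1}g\gamma_i\in\Gamma$. The operator $T_\pi$ on $H^1(\Gamma,E)$ is given on cocycles (satisfying $c(gh)=c(g)\cdot h+c(h)$) by $(T_\pi c)(g)=\sum_{i=1}^m c(\gamma_{j(i)}^{-1}g\gamma_i)\cdot\gamma_i^{\iota}$, where $\gamma^\iota=\det(\gamma)\gamma^{-1}$. Let $\mathbb{H}$ be the commutative polynomial ring over $\mathbb{Z}$ on the symbols $T_\pi$ for all primes $\pi$ of $\mathcal{O}$; it acts on all these cohomology groups. A Hecke eigenvalue system with values in $\mathbb{F}_\ell$ is a ring homomorphism $\Phi:\mathbb{H}\to\mathbb{F}_\ell$. It occurs in an $\mathbb{F}_\ell$-vector space $A$ with $\mathbb{H}$-action if there is a nonzero $v\in A$ with $Tv=\Phi(T)v$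 for all $T\in\mathbb{H}$. *)

(* Defs.v *)
From HB Require Import structures.
From mathcomp Require Import all_boot all_order all_algebra all_field.
From mathcomp Require Import boolp classical_sets cardinality.
From mathcomp Require Import finmap.
From mathcomp.multinomials Require Import monalg.

Set Implicit Arguments.
Unset Strict Implicit.
Unset Printing Implicit Defensive.

Import Order.TTheory GRing.Theory Num.Theory.

Local Open Scope ring_scope.
Local Open Scope quotient_scope.

Section IntegerRing.
Variable K : fieldExtType rat.

Definition integer_pred : {pred K} :=
  fun x => `[< integralOver (intr : int -> K) x >].

Fact integer_subring_closed : subring_closed integer_pred.
Proof.
split; first by apply/asboolP; apply: integral1.
- by move=> x y /asboolP ix /asboolP iy; apply/asboolP; apply: integral_sub.
- by move=> x y /asboolP ix /asboolP iy; apply/asboolP; apply: integral_mul.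
Qed.

HB.instance Definition _ :=
  GRing.isSubringClosed.Build K integer_pred integer_subring_closed.

Record integer_ring : predArgType :=
  IntegerRing { Oval :> K; _ : Oval \in integer_pred }.

HB.instance Definition _ := [isSub for Oval].
HB.instance Definition _ := [Choice of integer_ring by <:].
HB.instance Definition _ := [SubChoice_isSubComNzRing of integer_ring by <:].

End IntegerRing.

Notation "''O_' K" := (integer_ring K) (at level 8, K at level 2, format "''O_' K") : type_scope.

Section Arithmetic.
Variable K : fieldExtType rat.
Implicit Types (x y p : 'O_K) (I J a : {pred 'O_K}).

Definition imaginary_quadratic : Prop :=
  \dim {:K} = 2%N /\
  forall phi : {rmorphism K -> algC}, exists z : K, phi z \isn't Num.real.

(* [idealr_closed] and [Idealr] of MathComp only cover proper ideals. *)
Definition is_ideal I : Prop :=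
  [/\ 0 \in I, {in I &, forall x y, x + y \in I}
    & forall x, {in I, forall y, x * y \in I}].

(* I and J have the same class in the ideal class group: alpha I = beta J. *)
Definition same_ideal_class I J : Prop :=
  exists alpha beta : 'O_K, [/\ alpha != 0, beta != 0 &
    forall x, (exists2 y, y \in I & x = alpha * y) <->
              (exists2 y, y \in J & x = beta * y)].

Definition nonzero_ideal I : Prop := is_ideal I /\ exists2 x, x \in I & x != 0.

Definition class_number_one : Prop :=
  forall I J, nonzero_ideal I -> nonzero_ideal J -> same_ideal_class I J.

Definition divides x y : Prop := exists z, y = z * x.

Definition prime_element p : Prop :=
  [/\ p != 0, ~ divides p 1 &
      forall x y, divides p (x * y) -> divides p x \/ divides p y].

(* l = lam * lamb, where lam is prime, lamb is its complex conjugate, and the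
   two prime ideals that they generate are distinct. *)
Definition splits_as (l : nat) (lam lamb : 'O_K) : Prop :=
  [/\ prime_element lam, prime_element lamb, l%:R = lam * lamb,
      forall phi : {rmorphism K -> algC}, phi (val lamb) = (phi (val lam))^*
    & ~ (divides lam lamb /\ divides lamb lam)].

Definition prime_to a (l : nat) : Prop :=
  exists2 x, x \in a & exists y, x + l%:R * y = 1.

Definition prime_pred : {pred 'O_K} := fun p => `[< prime_element p >].

(* The prime elements index the symbols T_pi. *)
Definition prime_elt := {p : 'O_K | p \in prime_pred}.

End Arithmetic.

Section Reduction.
Variables (K : fieldExtType rat) (l : nat) (l_pr : prime l).

Definition l_ideal of prime l : {pred 'O_K} :=
  fun x => `[< divides l%:R x >].

Fact l_ideal_closed : idealr_closed (l_ideal l_pr).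
Proof.
split.
- by apply/asboolP; exists 0; rewrite mul0r.
- apply/negP => /asboolP [[y y_int] /(congr1 val)].
  rewrite rmorph1 rmorphM rmorph_nat /= => ly.
  case/asboolP: y_int => p p_mon py0.
  have key n (q : {poly int}) : (size q <= n)%N ->
      exists m : int, (map_poly (intr : int -> K) q).[y] * l%:R ^+ n.-1
                      = (q`_n.-1 + m * l%:Z)%:~R.
    case: n => [|n] sq.
      exists 0; move: sq; rewrite leqn0 size_poly_eq0 => /eqP->.
      by rewrite rmorph0 horner0 mul0r coef0 mul0r addr0.
    exists (\sum_(i < n) q`_i * l%:Z ^+ (n - i.+1)).
    have sq' : (size (map_poly (intr : int -> K) q) <= n.+1)%N.
      exact: leq_trans (size_poly _ _) sq.
    rewrite (horner_coef_wide _ sq') /= mulr_suml big_ord_recr /=.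
    rewrite addrC rmorphD /= coef_map /=; congr (_ + _).
      by rewrite -mulrA -exprMn -ly expr1n mulr1.
    rewrite mulr_suml rmorph_sum /=; apply: eq_bigr => i _.
    rewrite coef_map /= !rmorphM rmorphXn /= -!mulrA; congr (_ * _).
    rewrite -exprSr -subSn ?subSS //.
    have -> : (l%:R : K) ^+ n = l%:R ^+ i * l%:R ^+ (n - i).
      by rewrite -exprD subnKC // ltnW.
    by rewrite mulrA -exprMn -ly expr1n mul1r.
  have [m] := key _ p (leqnn _).
  rewrite (rootP py0) mul0r -lead_coefE (monicP p_mon) => /esym/eqP.
  have -> (z : int) : (z%:~R : K) = in_alg K (z%:~R) by rewrite rmorph_int.
  rewrite fmorph_eq0 intr_eq0 addr_eq0 => /eqP l_1.
  have : (l%:Z %| (1 : int)%R)%Z by rewrite l_1 -mulNr dvdz_mull.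
  by rewrite dvdzE /= dvdn1 => /eqP l1; move: l_pr; rewrite l1.
- move=> x u v /asboolP[y ->] /asboolP[z ->]; apply/asboolP.
  by exists (x * y + z); rewrite mulrDl mulrA.
Qed.

HB.instance Definition _ := isIdealr.Build 'O_K (l_ideal l_pr) l_ideal_closed.

Definition residue_ring := {ideal_quot (l_ideal l_pr)}.
HB.instance Definition _ := GRing.ComNzRing.on residue_ring.

(* The semigroup M_2(O) inside GL_2(K). *)
Definition M2O : {pred 'M[K]_2} :=
  fun g => (g \is a mxOver (@integer_pred K)) && (\det g != 0).

(* Only meaningful for matrices with entries in O. *)
Definition mx_to_O (g : 'M[K]_2) : 'M['O_K]_2 := map_mx (insubd (0 : 'O_K)) g.

Definition mx_mod_l (g : 'M[K]_2) : 'M[residue_ring]_2 :=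
  map_mx (\pi_residue_ring) (mx_to_O g).

Definition GL2 (R : nzRingType) (g : 'M[R]_2) : Prop :=
  exists h : 'M[R]_2, g *m h = 1%:M /\ h *m g = 1%:M.

End Reduction.

Section IrreducibleModules.
Variable F : fieldType.

(* The matrix of P |-> P(aX+bY, cX+dY) in the basis X^(k-i) Y^i (0 <= i <= k)
   of Sym_k, acting on row vectors of coordinates; the coefficient of
   X^(k-j) Y^j is read off after setting Y := 1. *)
Definition sym_mx (k : nat) (g : 'M[F]_2) : 'M[F]_k.+1 :=
  \matrix_(i, j)
    ((g 0 0 *: 'X + (g 0 1)%:P) ^+ (k - i) *
     (g 1 0 *: 'X + (g 1 1)%:P) ^+ i)`_(k - j).

(* The action on (det^a (x) Sym_r) (x) (det^b (x) Sym_s) of a pair (g1, g2),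
   g1 acting on the first factor and g2 on the second.  The matrix Q stands for
   \sum_(i, j) Q i j X^(r-i) Y^i (x) X^(s-j) Y^j. *)
Definition irr_act (a b r s : nat) (g1 g2 : 'M[F]_2) (Q : 'M[F]_(r.+1, s.+1))
  : 'M[F]_(r.+1, s.+1) :=
  (\det g1 ^+ a * \det g2 ^+ b) *: ((sym_mx r g1)^T *m Q *m sym_mx s g2).

End IrreducibleModules.

Section Coefficients.
Variables (K : fieldExtType rat) (l : nat) (l_pr : prime l).
Variables (lam lamb : 'O_K).

(* [red] is the reduction map O -> O/(p) = F_l. *)
Definition is_reduction (p : 'O_K) (red : {rmorphism 'O_K -> 'F_l}) : Prop :=
  forall x, red x = 0 <-> divides p x.

(* Where E is one of the irreducible modules E^{a,b}_{r,s}, the whole of M_2(O)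
   acts through reduction modulo lam on the first factor and modulo lamb on the
   second.  Being isomorphic to E^{a,b}_{r,s} over GL_2(O/(l)) is expressed with
   the matrices of M_2(O) that are invertible modulo l, since these act through
   GL_2(O/(l)) and map onto it. *)
Definition standard_on_irreducibles (E : vectType 'F_l)
    (act : 'M[K]_2 -> 'End(E)) : Prop :=
  forall (red redb : {rmorphism 'O_K -> 'F_l}),
    is_reduction lam red -> is_reduction lamb redb ->
  forall a b r s : nat,
    (a <= l - 2)%N -> (b <= l - 2)%N -> (r <= l - 1)%N -> (s <= l - 1)%N ->
  forall f : {linear E -> 'M['F_l]_(r.+1, s.+1)}, bijective f ->
  let intertwines g := forall e : E,
    f (act g e) = irr_act a b (map_mx red (mx_to_O g))
                              (map_mx redb (mx_to_O g)) (f e) in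
    (forall g : 'M[K]_2, g \in @M2O K -> GL2 (mx_mod_l l_pr g) -> intertwines g) ->
    forall g : 'M[K]_2, g \in @M2O K -> intertwines g.

(* A finite dimensional F_l[GL_2(O/(l))]-module, regarded as an M_2(O)-module.
   Both actions are right actions: g sends e to [gl2_act g e], resp. to
   [m2_act g e]. *)
Record coef_module := CoefModule {
  coef_space :> vectType 'F_l;
  gl2_act : 'M[residue_ring K l_pr]_2 -> 'End(coef_space);
  m2_act : 'M[K]_2 -> 'End(coef_space);
  gl2_act1 : gl2_act 1%:M = \1%VF;
  gl2_actM : forall g h, GL2 g -> GL2 h ->
    gl2_act (g *m h) = (gl2_act h \o gl2_act g)%VF;
  m2_act1 : m2_act 1%:M = \1%VF;
  m2_actM : forall g h : 'M[K]_2, g \in @M2O K -> h \in @M2O K ->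
    m2_act (g *m h) = (m2_act h \o m2_act g)%VF;
  m2_act_mod_l : forall g : 'M[K]_2, g \in @M2O K -> GL2 (mx_mod_l l_pr g) ->
    m2_act g = gl2_act (mx_mod_l l_pr g);
  m2_act_irr : standard_on_irreducibles m2_act
}.

End Coefficients.

Section Cohomology.
Variables (K : fieldExtType rat) (a : {pred 'O_K}).

Definition Gamma1 : {pred 'M[K]_2} := fun g =>
  [&& g \is a mxOver (@integer_pred K), \det g == 1,
      mx_to_O g 1 0 \in a & mx_to_O g 1 1 - 1 \in a].

Definition pi_tilde (p : 'O_K) : 'M[K]_2 :=
  \matrix_(i, j) (if i == j then if i == 0 then val p else 1 else 0).

Definition double_coset (p : 'O_K) : set 'M[K]_2 :=
  [set x | exists g h, [/\ g \in Gamma1, h \in Gamma1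
                         & x = g *m pi_tilde p *m h]]%classic.

(* The double coset of pi_tilde is the disjoint union of the cosets
   gamma Gamma1, gamma in s. *)
Definition coset_decomposition (p : 'O_K) (s : seq 'M[K]_2) : Prop :=
  [/\ uniq s,
      forall x, double_coset p x <->
        exists2 gamma, gamma \in s & exists2 h, h \in Gamma1 & x = gamma *m h
    & {in s &, forall gamma gamma', {in Gamma1 &, forall h h',
        gamma *m h = gamma' *m h' -> gamma = gamma'}}].

Definition coset_reps (p : 'O_K) : seq 'M[K]_2 :=
  xget [::] [set s | coset_decomposition p s]%classic.

Definition mx_iota (g : 'M[K]_2) : 'M[K]_2 := \det g *: invmx g.

Variables (l : nat) (l_pr : prime l) (lam lamb : 'O_K).
Variable E : coef_module l_pr lam lamb.

(* Only the values of a cochain on Gamma1 matter. *)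
Implicit Type c : 'M[K]_2 -> E.

Definition cocycle c : Prop :=
  {in Gamma1 &, forall g h, c (g *m h) = m2_act E h (c g) + c h}.

Definition coboundary c : Prop :=
  exists e : E, {in Gamma1, forall g, c g = m2_act E g e - e}.

(* For g in Gamma1 and gamma in the list of representatives, the inner sum has
   a single term: the one whose gamma' is gamma_(j(i)). *)
Definition hecke (p : 'O_K) c : 'M[K]_2 -> E := fun g =>
  \sum_(gamma <- coset_reps p)
    \sum_(gamma' <- coset_reps p | invmx gamma' *m g *m gamma \in Gamma1)
      m2_act E (mx_iota gamma) (c (invmx gamma' *m g *m gamma)).

End Cohomology.

Section HeckeAlgebra.
Variable K : fieldExtType rat.

(* Z[T_pi : pi a prime element of O]. *)
Definition hecke_ring : comNzRingType := {malg int[{cmonom (prime_elt K)}]}.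

Variables (a : {pred 'O_K}) (l : nat) (l_pr : prime l) (lam lamb : 'O_K).
Variable E : coef_module l_pr lam lamb.
Implicit Type c : 'M[K]_2 -> E.

(* The T_pi commute on cohomology, so that the order in which the factors of a
   monomial are applied is irrelevant there. *)
Definition hecke_monomial (m : {cmonom (prime_elt K)}) c : 'M[K]_2 -> E :=
  foldr (fun p c' => iter (m p) (hecke a (val p)) c') c (finsupp m).

Definition hecke_ring_act (T : hecke_ring) c : 'M[K]_2 -> E := fun g =>
  \sum_(m <- msupp T) hecke_monomial m c g *~ mcoeff m T.

(* Phi occurs in H^1(Gamma1(a), E): the class v of some cocycle c satisfies
   v <> 0 and T v = Phi(T) v for all T. *)
Definition occurs_in_H1 (Phi : {rmorphism hecke_ring -> 'F_l}) : Prop :=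
  exists c, [/\ cocycle a c, ~ coboundary a c
    & forall T : hecke_ring,
        coboundary a (fun g => hecke_ring_act T c g - Phi T *: c g)].

End HeckeAlgebra.

(* Main.v *)
From HB Require Import structures.
Require Import Defs.
From mathcomp Require Import all_boot all_order all_algebra all_field.
From mathcomp Require Import boolp classical_sets cardinality.
From mathcomp Require Import finmap.
From mathcomp.multinomials Require Import monalg.
From mathcomp Require Import ring lra zify.
(** A system of Hecke eigenvalues is determined by its values on the symbols
    T_p.  Only finitely many primes p are not coprime to l (they divide l, and
    O has finitely many elements of bounded norm), and the values lie in the
    finite field F_l, so it suffices to bound the systems away from l.  There
    the matrices entering T_p have determinant prime to l and act on the
    coefficients E through the finite group GL_2(O/(l)).

    Filter E by submodules with cyclic quotients.  Let U be the last step of the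
    filtration at which a given eigenclass is still nonzero in H^1(E / U), and
    U' the next one.  Up to a coboundary the class then takes its values in
    U' / U, and in H^1(U' / U) it is an eigenvector modulo the space B of
    classes that die in H^1(E / U), to which it does not belong
    (eigenclass_realised).  A cyclic module is a quotient M / W of the
    permutation module M on the residues modulo l of matrices with determinant
    prime to l, and M depends on neither E nor the class.  As Gamma_1(a) is
    finitely generated, a cocycle with values in M / W is determined by finitely
    many elements of a finite set.  Hence W, the class and B range over a finite
    set, and together they determine the eigenvalues, as the scalars by which
    the operators T_p act on a nonzero element modulo B (code_determines).

    Finite generation of Gamma_1(a) follows by Schreier's lemma from that of
    SL_2(O).  For the latter, the pigeonhole principle provides a constant bound
    and, for all c <> 0 and d in O, an integer n between 1 and that bound
    together with m in O such that n d + m c has smaller norm than c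
    (weak_euclidean_division).  As O is principal, (m, n) divided by its gcd is
    the first column of a matrix h of determinant 1, and if (c, d) is the lower
    row of g then g h has a smaller lower left entry.  Up to transvections only
    finitely many h occur, and the descent ends with an upper triangular
    matrix. *)

Set Implicit Arguments.
Unset Strict Implicit.
Unset Printing Implicit Defensive.
Import Order.TTheory GRing.Theory Num.Theory.
Local Open Scope ring_scope.

(** * Coordinates in a quadratic field *)

Section QuadraticCoordinates.
Variables (K : fieldExtType rat) (w : K).

Definition re_coord (x : K) : rat := coord [tuple 1; w] 0 x.
Definition im_coord (x : K) : rat := coord [tuple 1; w] 1 x.

Hypothesis w_basis : basis_of fullv [tuple 1; w].

Lemma re_im x : x = (re_coord x)%:A + im_coord x *: w.
Proof.
rewrite {1}(coord_basis w_basis (memvf x)) big_ord_recl big_ord1 /=.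
by congr (_ + coord _ _ _ *: _); apply: val_inj.
Qed.

Lemma re_im_coord a b :
  (re_coord (a%:A + b *: w) = a) * (im_coord (a%:A + b *: w) = b).
Proof.
have fr : free [tuple 1; w] by case/andP: w_basis.
have e0 i : coord [tuple 1; w] i 1 = (i == 0)%:R.
  by rewrite [i == 0]eq_sym; exact: (coord_free 0 i fr).
have e1 i : coord [tuple 1; w] i w = (i == 1)%:R.
  by rewrite [i == 1]eq_sym; exact: (coord_free 1 i fr).
rewrite /re_coord /im_coord !linearD !linearZ /= !e0 !e1.
by rewrite !mulr0 !mulr1 addr0 add0r.
Qed.

Variable r : rat.
Hypothesis w_sqr : w ^+ 2 = r%:A.

Lemma re_imM x y :
  (re_coord (x * y) = re_coord x * re_coord y + r * im_coord x * im_coord y) *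
  (im_coord (x * y) = re_coord x * im_coord y + im_coord x * re_coord y).
Proof.
have -> : x * y =
    (re_coord x * re_coord y + r * im_coord x * im_coord y)%:A +
    (re_coord x * im_coord y + im_coord x * re_coord y) *: w.
  rewrite {1}(re_im x) {1}(re_im y) -!(mulr_algl _ w) -!in_algE !rmorphD !rmorphM /=.
  by move: w_sqr; rewrite -in_algE => <-; ring.
by rewrite !re_im_coord.
Qed.

Lemma re1 : re_coord 1 = 1.
Proof. by have /= := (re_im_coord 1 0).1; rewrite scale0r addr0 scale1r. Qed.

Lemma im1 : im_coord 1 = 0.
Proof. by have /= := (re_im_coord 1 0).2; rewrite scale0r addr0 scale1r. Qed.

Lemma re_coordB x y : re_coord (x - y) = re_coord x - re_coord y.
Proof. by rewrite /re_coord linearB. Qed.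
Lemma im_coordB x y : im_coord (x - y) = im_coord x - im_coord y.
Proof. by rewrite /im_coord linearB. Qed.

(** Over a quadratic field a complex embedding is the choice of a square root of
    w^2: the coordinates of an element determine its image. *)
Lemma quadratic_embedding (s : algC) : s ^+ 2 = ratr r ->
  exists phi : {rmorphism K -> algC},
    forall x, phi x = ratr (re_coord x) + ratr (im_coord x) * s.
Proof.
move=> s2.
pose phi x : algC := ratr (re_coord x) + ratr (im_coord x) * s.
have phi_add : zmod_morphism phi.
  move=> x y; rewrite /phi re_coordB im_coordB !rmorphB /=; ring.
have phi_mul : monoid_morphism phi.
  split; first by rewrite /phi re1 im1 rmorph1 rmorph0 mul0r addr0.
  by move=> x y; rewrite /phi !re_imM !rmorphD !rmorphM /= -s2; ring.
pose phiA := GRing.isZmodMorphism.Build K algC phi phi_add.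
pose phiM := GRing.isMonoidMorphism.Build K algC phi phi_mul.
pose phiR : {rmorphism K -> algC} := HB.pack phi phiA phiM.
by exists phiR.
Qed.
End QuadraticCoordinates.

Lemma quadratic_basis (K : fieldExtType rat) (w : K) :
  \dim {:K} = 2%N -> w \notin 1%VS -> basis_of fullv [tuple 1; w].
Proof.
move=> dimK w1; rewrite basisEfree subvf dimK leqnn !andbT.
rewrite (perm_free (_ : perm_eq _ [:: w; 1])) ?(perm_catC [:: 1] [:: w]) //.
by rewrite free_cons span_seq1 w1 seq1_free oner_eq0.
Qed.

Definition imaginary_generator (K : fieldExtType rat) (w : K) (D : nat) : Prop :=
  [/\ (0 < D)%N, basis_of fullv [tuple 1; w] & w ^+ 2 = (- D%:R)%:A].

(** Completing the square and clearing denominators produce w; were w^2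
    nonnegative, the field would have a real embedding. *)
Lemma imaginary_quadratic_generator (K : fieldExtType rat) :
  imaginary_quadratic K -> exists (w : K) (D : nat), imaginary_generator w D.
Proof.
case=> dimK imK.
have [w0 w0n1] : exists w0 : K, w0 \notin 1%VS.
  apply/not_existsP => all1.
  have : (fullv <= (1%VS : {vspace K}))%VS.
    by apply/subvP => x _; apply/negPn/negP => /all1.
  by move/dimvS; rewrite dimK dimv1.
have b0 := quadratic_basis dimK w0n1.
set al := re_coord w0 (w0 ^+ 2); set be := im_coord w0 (w0 ^+ 2).
pose r := al + be ^+ 2 / 4%:R.
pose d : rat := (denq r)%:~R.
have dn0 : d != 0 by rewrite intr_eq0 denq_neq0.
pose w := d *: (w0 - (be / 2%:R)%:A).
have w_1 : w \notin 1%VS.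
  rewrite /w rpredZeq (negPf dn0) /=; apply: contra w0n1 => h.
  by rewrite -[w0](subrK (be / 2%:R)%:A) memvD // memvZ // memv_line.
have b := quadratic_basis dimK w_1.
have w2 : w ^+ 2 = (d ^+ 2 * r)%:A.
  have E : w0 ^+ 2 = in_alg K al + in_alg K be * w0.
    by rewrite mulr_algl -re_im.
  have -> : w = in_alg K d * (w0 - in_alg K (be / 2%:R)) by rewrite mulr_algl.
  have h : in_alg K be = 2%:R * in_alg K (be / 2%:R).
    rewrite -[2%:R](rmorph_nat (in_alg K)) -rmorphM /=.
    by rewrite mulrCA divff ?mulr1 // pnatr_eq0.
  have h2 : in_alg K r = in_alg K al + in_alg K (be / 2%:R) ^+ 2.
    by rewrite -rmorphXn -rmorphD; congr (in_alg K _); rewrite /r; field.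
  have -> : (d ^+ 2 * r)%:A = in_alg K d ^+ 2 * in_alg K r.
    by rewrite -[LHS]in_algE (rmorphM (in_alg K)) (rmorphXn (in_alg K)).
  by rewrite h2 exprMn sqrrB E h; ring.
have d2r : d ^+ 2 * r = (denq r * numq r)%:~R.
  by rewrite rmorphM /= numqE -/d; ring.
exists w; exists (absz (denq r * numq r)).
have neg : denq r * numq r < 0.
  rewrite ltNge; apply/negP => ge0.
  pose s : algC := sqrtC (ratr (d ^+ 2 * r)).
  have [phi phiE] := quadratic_embedding b w2 (sqrtCK (ratr (d ^+ 2 * r))).
  have [z] := imK phi; rewrite phiE => /negP; apply.
  have sR : s \is Num.real.
    by rewrite ger0_real // sqrtC_ge0 ler0q d2r ler0z.
  by apply: rpredD; [|apply: rpredM => //]; apply: rpred_rat.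
split=> //; first by rewrite absz_gt0 lt_eqF.
by rewrite w2 d2r pmulrn abszE (ltr0_norm neg) rmorphN opprK.
Qed.

(** * The integers of an imaginary quadratic field *)

Section ImaginaryIntegers.
Variables (K : fieldExtType rat) (w : K) (D : nat).
Hypothesis genw : imaginary_generator w D.

(** This is the field norm, since the conjugate of w is - w. *)
Definition quadratic_norm (x : K) : rat :=
  re_coord w x ^+ 2 + D%:R * im_coord w x ^+ 2.
Let N := quadratic_norm.

Lemma quadratic_normM x y : N (x * y) = N x * N y.
Proof.
case: genw => _ b w2; rewrite /N /quadratic_norm !(re_imM b w2); ring.
Qed.

Lemma quadratic_norm_ge0 x : 0 <= N x.
Proof. by rewrite addr_ge0 ?sqr_ge0 // mulr_ge0 ?sqr_ge0 ?ler0n. Qed.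

Lemma quadratic_norm_eq0 x : (N x == 0) = (x == 0).
Proof.
case: genw => D0 b w2; apply/eqP/eqP => [|->]; last first.
  by rewrite /N /quadratic_norm /re_coord /im_coord !linear0; ring.
move/eqP; rewrite paddr_eq0 ?sqr_ge0 //; last first.
  by rewrite mulr_ge0 ?sqr_ge0 ?ler0n.
case/andP; rewrite sqrf_eq0 => /eqP r0.
rewrite mulrI_eq0 ?sqrf_eq0; last by apply/mulfI; rewrite pnatr_eq0 -lt0n.
by move/eqP=> i0; rewrite (re_im b x) r0 i0 !scale0r addr0.
Qed.

Lemma embedding_integer (phi : {rmorphism K -> algC}) x :
  x \in @integer_pred K -> phi x \in Aint.
Proof.
case/asboolP=> p mon_p /rootP px.
apply: (root_monic_Aint (p := map_poly intr p)).
- rewrite rootE -(rmorph0 phi) -[X in _ == phi X]px -horner_map -map_poly_comp.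
  by apply/eqP; congr (_.[_]); apply: eq_map_poly => c; rewrite /= rmorph_int.
- exact: monic_map.
- by apply/polyOverP=> i; rewrite coef_map /=; apply: intr_int.
Qed.

Lemma gen_integer : w \in @integer_pred K.
Proof.
case: genw => _ _ w2; apply/asboolP; exists ('X^2 + D%:R%:P).
  by rewrite monicE lead_coefDl ?lead_coefXn // size_polyXn size_polyC; case: eqP.
rewrite rootE rmorphD /= map_polyXn map_polyC /= hornerD hornerXn hornerC w2.
by rewrite scaleNr rmorph_nat scaler_nat addNr.
Qed.

(** The trace and the norm of an algebraic integer are rational numbers that are
    algebraic integers. *)
Lemma integer_trace_norm x : x \in @integer_pred K ->
  [/\ re_coord w x *+ 2 \is a Num.int & N x \is a Num.int].
Proof.
case: genw => D0 b w2 xO.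
pose s : algC := 'i * sqrtC D%:R.
have s2 : s ^+ 2 = ratr (- D%:R).
  by rewrite exprMn sqrCi sqrtCK mulN1r rmorphN rmorph_nat.
have [phi phiE] := quadratic_embedding b w2 s2.
have phiA := embedding_integer phi xO.
have cphiA : (phi x)^* \in Aint by rewrite Aint_aut.
have cphi : (phi x)^* = ratr (re_coord w x) - ratr (im_coord w x) * s.
  have sq : (sqrtC D%:R : algC)^* = sqrtC D%:R.
    by apply/CrealP; rewrite ger0_real // sqrtC_ge0 ler0n.
  have cs : s^* = - s by rewrite [LHS]rmorphM /= conjCi sq mulNr.
  have cq q : (ratr q : algC)^* = ratr q by apply/CrealP/rpred_rat.
  by rewrite phiE rmorphD [X in _ + X]rmorphM /= !cq cs mulrN.
have toint (q : rat) : (ratr q : algC) \in Aint -> q \is a Num.int.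
  by move=> qA; rewrite -Cint_rat; apply: Cint_rat_Aint => //; apply: Crat_rat.
split; apply: toint.
- have -> : ratr (re_coord w x *+ 2) = phi x + (phi x)^*.
    by rewrite cphi phiE rmorphMn /=; ring.
  by rewrite rpredD.
- have -> : ratr (N x) = phi x * (phi x)^*.
    rewrite cphi phiE /N /quadratic_norm rmorphD rmorphM !rmorphXn rmorph_nat.
    have -> : D%:R = - s ^+ 2 :> algC by rewrite s2 rmorphN rmorph_nat opprK.
    by ring.
  by rewrite rpredM.
Qed.

Definition integer_norm (x : 'O_K) : nat := absz (numq (N (val x))).

Lemma integer_normE x : (integer_norm x)%:R = N (val x).
Proof.
have [_ /intrP[m NE]] := integer_trace_norm (valP x).
have m0 : 0 <= m by rewrite -(ler0z rat) -NE quadratic_norm_ge0.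
by rewrite /integer_norm NE numq_int pmulrn gez0_abs.
Qed.

Lemma integer_normM x y :
  integer_norm (x * y) = (integer_norm x * integer_norm y)%N.
Proof.
by apply/eqP; rewrite -(eqr_nat rat) natrM !integer_normE quadratic_normM.
Qed.

Lemma integer_norm_eq0 x : (integer_norm x == 0%N) = (x == 0).
Proof.
by rewrite -(eqr_nat rat) integer_normE quadratic_norm_eq0 -(inj_eq val_inj).
Qed.

Lemma integer_norm_nat n : integer_norm n%:R = (n ^ 2)%N.
Proof.
apply/eqP; rewrite -(eqr_nat rat) natrX integer_normE rmorph_nat.
have := re_im_coord (let: And3 _ b _ := genw in b) n%:R 0.
rewrite scale0r addr0 scaler_nat /N /quadratic_norm => -[-> ->]; apply/eqP; ring.
Qed.

Definition symmetric_range (R : nat) : seq int :=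
  [seq Posz k - Posz R | k <- iota 0 (R + R).+1].

Lemma mem_symmetric_range R (q : rat) (i : int) :
  q ^+ 2 <= R%:R -> i%:~R = q -> i \in symmetric_range R.
Proof.
move=> qR qi; have iR : i ^+ 2 <= R%:R.
  by rewrite -(ler_int rat) rmorphXn /= qi rmorph_nat.
apply/mapP; exists (absz (i + R%:Z)); last by nia.
by rewrite mem_iota; nia.
Qed.

(** The coordinates of an integer lie in a fixed lattice, and a bound on the norm
    bounds them. *)
Lemma finitely_many_bounded_norm M :
  exists s : seq 'O_K, forall x, (integer_norm x <= M)%N -> x \in s.
Proof.
have [D0 b w2] := genw.
have Dn0 : (D%:R : rat) != 0 by rewrite pnatr_eq0 -lt0n.
pose f (i j : int) : 'O_K :=
  insubd 0 ((i%:~R / 2%:R)%:A + (- j%:~R / (2 * D)%:R) *: w).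
exists [seq f i j | i <- symmetric_range (4 * M),
                    j <- symmetric_range (4 * D * M)].
move=> x xM.
have [/intrP[i iE] _] := integer_trace_norm (valP x).
(* The second integer is the trace of x w, which is - 2 D times im_coord w x. *)
have xwO : val x * w \in @integer_pred K.
  by apply: rpredM; [exact: valP|exact: gen_integer].
have [/intrP[j jE] _] := integer_trace_norm xwO.
have rew : re_coord w w = 0 /\ im_coord w w = 1.
  by have [] := re_im_coord b 0 1; rewrite scale0r add0r scale1r.
rewrite (re_imM b w2) rew.1 rew.2 mulr0 add0r mulr1 in jE.
have : N (val x) <= M%:R by rewrite -integer_normE ler_nat.
rewrite /N /quadratic_norm => NM.
have im2 := sqr_ge0 (im_coord w (val x)).
have re2 := sqr_ge0 (re_coord w (val x)).
have D1 : 1 <= D%:R :> rat by rewrite ler1n.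
apply/allpairsP; exists (i, j); split => /=.
- apply: (@mem_symmetric_range _ (re_coord w (val x) *+ 2)) => //.
  by rewrite natrM; nra.
- apply: (@mem_symmetric_range _ ((- D%:R * im_coord w (val x)) *+ 2)) => //.
  by rewrite !natrM; nra.
apply: val_inj; rewrite insubdK.
  rewrite {1}(re_im b (val x)) -iE -jE; congr (_%:A + _ *: _); first by field.
  by rewrite natrM; field.
have -> : (i%:~R / 2%:R)%:A + (- j%:~R / (2 * D)%:R) *: w = val x; last exact: valP.
  rewrite [RHS](re_im b (val x)) -iE -jE; congr (_%:A + _ *: _); first by field.
  by rewrite natrM; field.
Qed.

Definition gen_int : 'O_K := IntegerRing gen_integer.

Lemma coord_lattice (x : K) (c : rat) (a b : int) :
  (re_coord w (c *: x + (a%:~R + b%:~R * w)) = c * re_coord w x + a%:~R) *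
  (im_coord w (c *: x + (a%:~R + b%:~R * w)) = c * im_coord w x + b%:~R).
Proof.
have [_ bas _] := genw.
have -> : c *: x + (a%:~R + b%:~R * w) =
    (c * re_coord w x + a%:~R)%:A + (c * im_coord w x + b%:~R) *: w.
  have intA (z : int) : z%:~R = (z%:~R : rat)%:A :> K.
    by rewrite -[RHS]in_algE rmorph_int.
  rewrite {1}(re_im bas x) !intA mulr_algl scalerDr !scalerA !scalerDl.
  by rewrite addrACA.
by rewrite !(re_im_coord bas).
Qed.

(** The quotient a + b w is obtained by rounding down the coordinates of x / M. *)
Lemma lattice_remainder (M : nat) (x : 'O_K) : (0 < M)%N ->
  exists (a b : int) (r : 'O_K), x = r + M%:R * (a%:~R + b%:~R * gen_int) /\
    (integer_norm r <= M ^ 2 * D.+1)%N.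
Proof.
move=> M0; have M0' : 0 < M%:R :> rat by rewrite ltr0n.
pose a := Num.floor (re_coord w (val x) / M%:R).
pose b := Num.floor (im_coord w (val x) / M%:R).
exists a, b, (x - M%:R * (a%:~R + b%:~R * gen_int)); split; first by rewrite subrK.
rewrite -(ler_nat rat) integer_normE /=.
have -> : val x - val (M%:R * (a%:~R + b%:~R * gen_int)) =
   (1 : rat) *: val x + ((- (M%:Z * a))%:~R + (- (M%:Z * b))%:~R * w).
  rewrite scale1r [val (_ * _)]rmorphM rmorph_nat rmorphD rmorphM !rmorph_int /=.
  by rewrite !rmorphN !rmorphM /= -pmulrn; ring.
rewrite /N /quadratic_norm !coord_lattice !mul1r.
have /andP[a1 a2] := floor_itv (re_coord w (val x) / M%:R).
have /andP[b1 b2] := floor_itv (im_coord w (val x) / M%:R).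
move: a1 a2 b1 b2; rewrite -/a -/b ler_pdivlMr // ltr_pdivrMr // ler_pdivlMr // ltr_pdivrMr //.
rewrite !rmorphN !rmorphM !rmorphD /= -pmulrn -[D.+1]addn1 natrD.
set u := re_coord _ _; set v := im_coord _ _ => a1 a2 b1 b2.
have u2 : (u - M%:R * a%:~R) ^+ 2 <= M%:R ^+ 2 by nra.
have v2 : (v - M%:R * b%:~R) ^+ 2 <= M%:R ^+ 2 by nra.
have D0 : 0 <= D%:R :> rat by rewrite ler0n.
nra.
Qed.

Lemma finitely_many_residues M : (0 < M)%N ->
  exists s : seq 'O_K, forall x, exists2 r, r \in s & exists y, x = r + M%:R * y.
Proof.
move=> M0; have [s sP] := finitely_many_bounded_norm (M ^ 2 * D.+1).
exists s => x; have [a [b [r [xE rM]]]] := lattice_remainder x M0.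
by exists r; [exact: sP | exists (a%:~R + b%:~R * gen_int)].
Qed.

(** Modulo the lattice spanned by 1 and w every integer has a remainder of bounded
    norm. *)
Lemma integers_finitely_generated :
  exists s : seq 'O_K, forall P : 'O_K -> Prop,
    P 0 -> (forall x y, x \in s -> P y -> P (x + y)) -> forall x, P x.
Proof.
have [s sP] := finitely_many_bounded_norm (1 ^ 2 * D.+1).
exists ([:: 1; -1; gen_int; - gen_int] ++ s) => P P0 PD x.
have [a [b [r [-> rM]]]] := lattice_remainder x (ltn0Sn 0).
rewrite mul1r; apply: (PD); first by rewrite mem_cat sP ?orbT.
have addn (z : 'O_K) n y : z \in [:: 1; -1; gen_int; - gen_int] -> P y -> P (z *+ n + y).
  move=> zs Py; elim: n => [|n IH]; first by rewrite mulr0n add0r.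
  by rewrite mulrS -addrA; apply: (PD) => //; rewrite mem_cat zs.
have addz (z : 'O_K) (n : int) y : z \in [:: 1; -1; gen_int; - gen_int] ->
    - z \in [:: 1; -1; gen_int; - gen_int] -> P y -> P (n%:~R * z + y).
  move=> z1 z2 Py; rewrite mulrzl; case: n => n; first exact: addn.
  by rewrite NegzE mulrNz -mulNrz -pmulrn; apply: addn.
rewrite -[a%:~R]mulr1; apply: (addz); rewrite ?inE ?eqxx ?orbT //.
by rewrite -[_ * gen_int]addr0; apply: (addz); rewrite ?inE ?opprK ?eqxx ?orbT.
Qed.

Lemma quadratic_norm_conj (x : K) :
  in_alg K (N x) = x * (in_alg K (re_coord w x *+ 2) - x).
Proof.
have [_ b w2] := genw.
have xE : x = in_alg K (re_coord w x) + in_alg K (im_coord w x) * w.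
  by rewrite mulr_algl -re_im.
have DE : in_alg K D%:R = - w ^+ 2 by rewrite w2 scaleNr opprK.
move: xE; rewrite /N /quadratic_norm; move: (re_coord w x) (im_coord w x) => u v ->.
have -> : in_alg K (u ^+ 2 + D%:R * v ^+ 2) =
    in_alg K u ^+ 2 + in_alg K D%:R * in_alg K v ^+ 2.
  by rewrite rmorphD (rmorphM (in_alg K) D%:R) !(rmorphXn (in_alg K)).
rewrite DE (rmorphMn (in_alg K)); ring.
Qed.

(** The cofactor is the conjugate of x, that is, its trace minus x. *)
Lemma divides_integer_norm x : exists y : 'O_K, (integer_norm x)%:R = x * y.
Proof.
have [/intrP[t tE] _] := integer_trace_norm (valP x).
exists (t%:~R - x); apply: val_inj.
rewrite rmorph_nat rmorphM rmorphB rmorph_int /=.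
rewrite -(rmorph_nat (in_alg K)) integer_normE [LHS]quadratic_norm_conj tE.
by rewrite rmorph_int.
Qed.

(** The pigeonhole principle applied to the multiples of d / c modulo the lattice
    spanned by 1 and w: two of them fall in the same small box.  Euclidean division
    would ask for n = 1. *)
Lemma weak_euclidean_division : exists B : nat, forall c d : 'O_K, c != 0 ->
  exists (n : nat) (m : 'O_K),
    (0 < n <= B)%N /\ (integer_norm (n%:R * d + m * c)%R < integer_norm c)%N.
Proof.
pose k := D.+2; exists (k * k)%N => c d c0.
have vc0 : val c != 0 by rewrite (inj_eq val_inj _ 0).
pose z : K := val d / val c.
have zc : z * val c = val d by rewrite divfK.
pose cx (j : nat) := j%:R * re_coord w z; pose cy (j : nat) := j%:R * im_coord w z.
(* The index of the box of side 1 / k containing the fractional part of q. *)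
pose box (q : rat) := Num.floor (k%:R * (q - (Num.floor q)%:~R)).
have k1 : 1 <= k%:R :> rat by rewrite ler1n.
have boxP q : (box q)%:~R <= k%:R * (q - (Num.floor q)%:~R) < (box q)%:~R + 1.
  by have := floor_itv (k%:R * (q - (Num.floor q)%:~R)); rewrite rmorphD.
have box_lt q : (absz (box q) < k)%N /\ 0 <= box q.
  have /andP[q1 q2] := floor_itv q; rewrite rmorphD /= in q2.
  have /andP[f1 f2] := boxP q.
  have fk : box q < k%:Z by rewrite -(ltr_int rat) -pmulrn; nra.
  have f0 : -1 < box q by rewrite -(ltr_int rat) rmorphN; nra.
  by split; lia.
pose boxes (j : 'I_(k * k).+1) : 'I_k * 'I_k :=
  (Ordinal (box_lt (cx j)).1, Ordinal (box_lt (cy j)).1).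
have /injectivePn[i [j ij bij]] : ~~ injectiveb boxes.
  apply/negP => /injectiveP /leq_card; rewrite card_prod !card_ord; lia.
wlog {ij} lt_ij : i j bij / (i < j)%N.
  move=> W; have [|ji|/val_inj e] := ltngtP i j; [exact: W| | ].
    by apply: (W j i).
  by rewrite e eqxx in ij.
have close q1 q2 : absz (box q1) = absz (box q2) ->
    (k%:R * (q2 - q1 + (Num.floor q1 - Num.floor q2)%:~R)) ^+ 2 < 1.
  move=> e; have eb : box q1 = box q2.
    by rewrite -(gez0_abs (box_lt q1).2) -(gez0_abs (box_lt q2).2) e.
  have /andP[] := boxP q1; have /andP[] := boxP q2; rewrite eb rmorphB /=.
  set b := (box q2)%:~R; set a2 := (Num.floor q2)%:~R.
  set a1 := (Num.floor q1)%:~R => h1 h2 h3 h4.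
  have -> : k%:R * (q2 - q1 + (a1 - a2)) = k%:R * (q2 - a2) - k%:R * (q1 - a1).
    by rewrite -mulrBr; congr (_ * _); ring.
  move: h1 h2 h3 h4; set x := k%:R * _; set y := k%:R * _ => h1 h2 h3 h4.
  have t1 : x - y < 1 by lra.
  have t2 : -1 < x - y by lra.
  nra.
case: bij => /close cx_close /close cy_close.
pose m : 'O_K := (Num.floor (cx i) - Num.floor (cx j))%:~R +
                 (Num.floor (cy i) - Num.floor (cy j))%:~R * gen_int.
exists (j - i)%N, m; split.
  by have := ltn_ord j; lia.
have -> : integer_norm c = (1 * integer_norm c)%N by rewrite mul1n.
rewrite -(ltr_nat rat) natrM !integer_normE.
have -> : val ((j - i)%:R * d + m * c) = ((j - i)%:R *: z + val m) * val c.
  rewrite rmorphD !rmorphM rmorph_nat /= [RHS]mulrDl; congr (_ + _).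
  by rewrite scaler_nat [RHS]mulrnAl zc mulr_natl.
rewrite quadratic_normM mul1r gtr_pMl; last first.
  by rewrite lt0r quadratic_norm_ge0 quadratic_norm_eq0 vc0.
have -> : val m = (Num.floor (cx i) - Num.floor (cx j))%:~R +
                 (Num.floor (cy i) - Num.floor (cy j))%:~R * w.
  by rewrite rmorphD rmorphM !rmorph_int.
rewrite /N /quadratic_norm !coord_lattice.
have sub t : (j - i)%:R * t = j%:R * t - i%:R * t :> rat.
  by rewrite natrB ?mulrBl // ltnW.
rewrite !sub -/(cx i) -/(cx j) -/(cy i) -/(cy j).
move: cx_close cy_close; rewrite !exprMn.
set X := (cx j - cx i + _) ^+ 2; set Y := (cy j - cy i + _) ^+ 2 => hX hY.
have kD : k%:R = D%:R + 2 :> rat by rewrite /k -addn2 natrD.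
have D0 : 0 <= D%:R :> rat by rewrite ler0n.
rewrite kD in hX hY.
have X0 : 0 <= X by apply: sqr_ge0.
have Y0 : 0 <= Y by apply: sqr_ge0.
have X1 : (D%:R + 1) * X < 1 by nra.
have Y1 : (D%:R + 1) * Y < 1 by nra.
nra.
Qed.
End ImaginaryIntegers.

(** * Class number one *)

Section Bezout.
Variable K : fieldExtType rat.
Implicit Types x y z : 'O_K.

Lemma integer_mulf_eq0 x y : x * y = 0 -> x = 0 \/ y = 0.
Proof.
move/(congr1 val); rewrite rmorphM rmorph0 => /eqP; rewrite mulf_eq0.
by case/orP => /eqP h; [left | right]; apply: val_inj.
Qed.

Lemma integer_mulfI x y z : x != 0 -> x * y = x * z -> y = z.
Proof.
move=> /eqP x0 /eqP; rewrite -subr_eq0 -mulrBr => /eqP /integer_mulf_eq0[//|].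
by move/eqP; rewrite subr_eq0 => /eqP.
Qed.

Definition ideal2 x y : {pred 'O_K} := fun z => `[< exists u v, z = x * u + y * v >].

Lemma ideal2_is_ideal x y : is_ideal (ideal2 x y).
Proof.
split; first by apply/asboolP; exists 0, 0; rewrite !mulr0 addr0.
- move=> _ _ /asboolP[u [v ->]] /asboolP[u' [v' ->]]; apply/asboolP.
  by exists (u + u'), (v + v'); ring.
- move=> z _ /asboolP[u [v ->]]; apply/asboolP.
  by exists (z * u), (z * v); ring.
Qed.

(** The ideal (x, y) has the class of the unit ideal, so it is principal. *)
Lemma bezout_class_number_one x y : class_number_one K -> x != 0 \/ y != 0 ->
  exists d x' y' u v,
    [/\ d != 0, x = d * x', y = d * y' & x' * u + y' * v = 1].
Proof.
move=> cl1 xy0.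
have xI : x \in ideal2 x y by apply/asboolP; exists 1, 0; ring.
have yI : y \in ideal2 x y by apply/asboolP; exists 0, 1; ring.
have nzI : nonzero_ideal (ideal2 x y).
  by split; [exact: ideal2_is_ideal | case: xy0 => ?; [exists x | exists y]].
have nzJ : nonzero_ideal (predT : {pred 'O_K}).
  by split; [split | exists 1; rewrite ?oner_eq0].
have [al [be [al0 be0 same]]] := cl1 _ _ nzI nzJ.
have [d dI beE] : exists2 d, d \in ideal2 x y & be = al * d.
  by apply/same; exists 1; rewrite ?mulr1.
have div_d z : z \in ideal2 x y -> exists z', z = d * z'.
  move=> zI; have [z' _ e] : exists2 y0, y0 \in (predT : {pred 'O_K}) & al * z = be * y0.
    by apply/same; exists z.
  by exists z'; apply: (integer_mulfI al0); rewrite e beE mulrA.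
have d0 : d != 0 by apply: contra be0 => /eqP d0; rewrite beE d0 mulr0.
have [x' xE] := div_d x xI; have [y' yE] := div_d y yI.
have /asboolP[u [v dE]] := dI.
exists d, x', y', u, v; split=> //.
by apply: (integer_mulfI d0); rewrite mulrDr !mulrA -xE -yE -dE mulr1.
Qed.
End Bezout.

(** * Matrices of size two *)

Section TwoByTwo.
Variable R : comNzRingType.
Implicit Types (A B : 'M[R]_2) (a b c d : R).

Definition mx22 a b c d : 'M[R]_2 :=
  \matrix_(i, j) if i == 0 then if j == 0 then a else b
                 else if j == 0 then c else d.

Lemma mx22E A : A = mx22 (A 0 0) (A 0 1) (A 1 0) (A 1 1).
Proof.
apply/matrixP=> i j; rewrite mxE.
have ord2 (k : 'I_2) : k = if k == 0 then 0 else 1.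
  by apply: val_inj; case: k => [[|[|]]].
by rewrite {1}(ord2 i) {1}(ord2 j); case: ifP; case: ifP.
Qed.

Lemma mul_mx22 a b c d a' b' c' d' :
  mx22 a b c d *m mx22 a' b' c' d' =
  mx22 (a * a' + b * c') (a * b' + b * d') (c * a' + d * c') (c * b' + d * d').
Proof.
have o1 : lift ord0 (ord0 : 'I_1) = 1 by apply: val_inj.
by rewrite [LHS]mx22E; congr mx22; rewrite !mxE big_ord_recl big_ord1 !mxE !o1.
Qed.

Lemma mx22_id : mx22 1 0 0 1 = 1%:M.
Proof. by rewrite [RHS]mx22E !mxE. Qed.

Lemma det_mx22 a b c d : \det (mx22 a b c d) = a * d - b * c.
Proof.
have o1 : lift ord0 (ord0 : 'I_1) = 1 by apply: val_inj.
rewrite (expand_det_row _ 0) big_ord_recl big_ord1 /cofactor !det_mx11 !mxE o1 /=.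
by rewrite !expr0 /= ; ring.
Qed.

Lemma adj_mx22 a b c d : \adj (mx22 a b c d) = mx22 d (- b) (- c) a.
Proof.
rewrite [LHS]mx22E; congr mx22; rewrite !mxE /cofactor det_mx11 !mxE /=; ring.
Qed.

Lemma mulmx_adj A : \det A = 1 -> A *m \adj A = 1%:M.
Proof. by move=> dA; rewrite mul_mx_adj dA. Qed.

Lemma adjmx_mul A : \det A = 1 -> \adj A *m A = 1%:M.
Proof. by move=> dA; rewrite mul_adj_mx dA. Qed.

Lemma det_adj22 A : \det (\adj A) = \det A.
Proof. by rewrite [A]mx22E adj_mx22 !det_mx22; ring. Qed.

(** The monoid, not the group: a generating list also contains inverses, and then
    an induction over words has only one step. *)
Inductive generated (s : seq 'M[R]_2) : 'M[R]_2 -> Prop :=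
| generated1 : generated s 1%:M
| generatedM x g : x \in s -> generated s g -> generated s (x *m g).

Lemma generated_mul s g h : generated s g -> generated s h -> generated s (g *m h).
Proof.
move=> sg sh; elim: sg => [|x g' xs _ IH]; first by rewrite mul1mx.
by rewrite -mulmxA; apply: generatedM.
Qed.

Lemma generated_mem s x : x \in s -> generated s x.
Proof. by move=> xs; rewrite -[x]mulmx1; right; [exact: xs | left]. Qed.
End TwoByTwo.

(** * Finite generation of SL_2(O) *)

Section SL2Generation.
Variables (K : fieldExtType rat) (w : K) (D : nat).
Hypothesis genw : imaginary_generator w D.
Hypothesis cl1 : class_number_one K.
Implicit Types (x y : 'O_K) (g h : 'M['O_K]_2).

Definition transvection x : 'M['O_K]_2 := mx22 1 x 0 1.

Lemma det_transvection x : \det (transvection x) = 1.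
Proof. by rewrite det_mx22; ring. Qed.

Lemma transvectionD x y : transvection (x + y) = transvection x *m transvection y.
Proof. by rewrite mul_mx22; congr mx22; ring. Qed.

Lemma transvectionNK x : transvection x *m transvection (- x) = 1%:M.
Proof. by rewrite -transvectionD subrr -mx22_id. Qed.

(** The identity stands in for a column that no matrix of determinant 1 has. *)
Definition matrix_with_first_column x y : 'M['O_K]_2 :=
  xget 1%:M [set h | [/\ \det h = 1, h 0 0 = x & h 1 0 = y]]%classic.

Lemma matrix_with_first_columnP h : \det h = 1 ->
  let h' := matrix_with_first_column (h 0 0) (h 1 0) in
  [/\ \det h' = 1, h' 0 0 = h 0 0 & h' 1 0 = h 1 0].
Proof.
move=> dh.
have : exists g, [/\ \det g = 1, g 0 0 = h 0 0 & g 1 0 = h 1 0] by exists h.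
by move/(xgetPex 1%:M).
Qed.

(** Descent on the norm of the lower left entry, by right multiplication with
    matrices h of determinant 1 whose lower left entry divides an integer between 1
    and the constant B of the weak Euclidean division.  There are finitely many such
    entries, and transvections on both sides reduce h to one matrix for each value of
    the lower left entry and each residue of the upper left one. *)
Lemma SL2_finitely_generated : exists s : seq 'M['O_K]_2,
  {in s, forall g, \det g = 1} /\ forall g, \det g = 1 -> generated s g.
Proof.
have [B BP] := weak_euclidean_division genw.
have [units unitsP] := finitely_many_bounded_norm genw 1.
have [lowers lowersP] := finitely_many_bounded_norm genw (B ^ 2).
have [trans transP] := integers_finitely_generated genw.
have [res resP] := finitely_many_residues genw (fact_gt0 B).
pose s := [seq h <- [seq mx22 u 0 0 v | u <- units, v <- units] ++
                    [seq transvection x | x <- trans] ++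
                    [seq matrix_with_first_column r c | r <- res, c <- lowers]
              | \det h == 1].
exists s; split; first by move=> x; rewrite mem_filter => /andP[/eqP].
have gen_trans x : generated s (transvection x).
  elim/transP: x => [|x y xs IH]; first by rewrite /transvection mx22_id; left.
  rewrite transvectionD; right=> //; rewrite mem_filter det_transvection eqxx /=.
  by rewrite !mem_cat map_f ?orbT.
have gen_upper g : \det g = 1 -> g 1 0 = 0 -> generated s g.
  move=> dg g10; rewrite [g]mx22E g10 in dg *; move: dg; rewrite det_mx22 mulr0 subr0.
  set a := g 0 0; set b := g 0 1; set d := g 1 1 => ad1.
  have -> : mx22 a b 0 d = mx22 a 0 0 d *m transvection (d * b).
    by rewrite mul_mx22; congr mx22; rewrite ?mulrA ?ad1; ring.
  apply: generated_mul => //; apply: generated_mem.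
  rewrite mem_filter det_mx22 ad1 mulr0 subr0 eqxx !mem_cat /=; apply/orP; left.
  have := integer_normM genw a d; rewrite ad1 (integer_norm_nat genw 1).
  move/esym/eqP; rewrite muln_eq1 => /andP[/eqP na /eqP nd].
  by apply: allpairs_f; apply: unitsP; rewrite ?na ?nd.
have gen_bounded h n q : \det h = 1 -> (0 < n <= B)%N -> n%:R = h 1 0 * q ->
    generated s h.
  move=> dh /andP[n0 nB] nq.
  have h10 : h 1 0 \in lowers.
    apply: lowersP; have := integer_normM genw (h 1 0) q.
    rewrite -nq integer_norm_nat // => e.
    apply: (@leq_trans (n ^ 2)); last by rewrite leq_exp2r.
    by apply: dvdn_leq; rewrite ?expn_gt0 ?n0 // e dvdn_mulr.
  have [q' Bq'] : exists q', B`!%:R = h 1 0 * q'.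
    have /dvdnP[k ->] : (n %| B`!)%N by apply: dvdn_fact; rewrite n0.
    by exists (q * k%:R); rewrite mulrA -nq -natrM mulnC.
  (* B`! is a multiple of the lower left entry, hence a transvection on the left
     replaces the upper left entry by its residue modulo B`!. *)
  have [r rres [y h00]] := resP (h 0 0).
  pose h' := transvection (- (q' * y)) *m h.
  have dh' : \det h' = 1 by rewrite det_mulmx det_transvection mul1r.
  have [h'00 h'10] : h' 0 0 = r /\ h' 1 0 = h 1 0.
    rewrite /h' [h]mx22E mul_mx22 !mxE /= h00 Bq'; split; ring.
  have [] := matrix_with_first_columnP dh'; rewrite h'00 h'10.
  set h0 := matrix_with_first_column _ _ => dh0 h000 h010.
  have h0s : h0 \in s.
    by rewrite mem_filter dh0 eqxx !mem_cat allpairs_f ?orbT.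
  have -> : h = transvection (q' * y) *m (h0 *m (\adj h0 *m h')).
    by rewrite (mulmxA h0) (mulmx_adj dh0) mul1mx mulmxA transvectionNK mul1mx.
  apply: generated_mul => //; right=> //; apply: gen_upper.
    by rewrite det_mulmx det_adj22 dh0 dh' mul1r.
  rewrite [h0]mx22E adj_mx22 [h']mx22E mul_mx22 mxE /= h000 h010 h'00 h'10; ring.
move=> g; have [k] := ubnP (integer_norm w D (g 1 0)); elim: k g => // k IH g gk dg.
have [g10|g10] := eqVneq (g 1 0) 0; first exact: gen_upper.
have [n [m [nB lt_norm]]] := BP (g 1 0) (g 1 1) g10.
have n0 : n%:R != 0 :> 'O_K.
  by rewrite -(integer_norm_eq0 genw) integer_norm_nat //; nia.
have [d [m' [n' [u [v [d0 mE nE uv]]]]]] :=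
  bezout_class_number_one cl1 (or_intror (m != 0) n0).
(* The lower left entry of g *m h is g 1 0 * m' + g 1 1 * n'. *)
pose h := mx22 m' (- v) n' u.
have dh : \det h = 1 by rewrite det_mx22 -uv; ring.
have -> : g = g *m h *m \adj h by rewrite -mulmxA mulmx_adj // mulmx1.
apply: generated_mul.
  apply: IH; last by rewrite det_mulmx dg dh mul1r.
  rewrite [g]mx22E mul_mx22 mxE /=.
  move: lt_norm; rewrite mE nE => lt_norm.
  have e : d * n' * g 1 1 + d * m' * g 1 0 = d * (g 1 0 * m' + g 1 1 * n') by ring.
  move: lt_norm; rewrite e (integer_normM genw).
  have d_pos : (0 < integer_norm w D d)%N by rewrite lt0n (integer_norm_eq0 genw).
  move=> lt_norm'; apply: (leq_trans _ (gk : (_ <= k)%N)).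
  by apply: leq_ltn_trans lt_norm'; rewrite leq_pmull.
apply: (gen_bounded _ n (- d)) => //; first by rewrite det_adj22.
by rewrite adj_mx22 mxE /= nE; ring.
Qed.
End SL2Generation.

(** * Finite generation of Gamma_1(a) *)

(** Schreier's lemma: walking along a word in s and recording the coset at each
    step writes an element of H as a product of elements r x r'^-1 of H, where r
    and r' are coset representatives. *)
Lemma schreier (R : comNzRingType) (s t : seq 'M[R]_2) (H : 'M[R]_2 -> Prop) :
  {in t, forall r, \det r = 1} ->
  H 1%:M -> (forall g h, H g -> H h -> H (g *m h)) ->
  (forall g, H g -> \det g = 1 /\ H (\adj g)) ->
  (forall g, generated s g -> \det g = 1) ->
  (forall g, \det g = 1 -> exists2 r, r \in t & H (g *m \adj r)) ->
  exists S : seq 'M[R]_2, (forall g, g \in S -> H g) /\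
    forall g, generated s g -> H g -> generated S g.
Proof.
move=> t1 H1 HM HV s1 tP.
pose t' := 1%:M :: t.
pose S := [seq g <- t' ++ [seq r *m xr | r <- t', xr <- [seq x *m \adj r | x <- s, r <- t']]
             | `[< H g >]].
have SH g : g \in S -> H g by rewrite mem_filter => /andP[/asboolP].
have genH g : generated S g -> H g.
  by elim=> // x h xS _ Hh; apply: HM => //; apply: SH.
have t'1 r : r \in t' -> \det r = 1.
  by rewrite inE => /predU1P[->|/t1//]; rewrite det1.
have walk g : generated s g -> forall r, r \in t' ->
    exists2 r', r' \in t' & exists2 h, generated S h & r *m g = h *m r'.
  elim=> [|x h xs sh IH] r rt.
    by exists r => //; exists 1%:M; rewrite ?mulmx1 ?mul1mx //; left.
  have drx : \det (r *m x) = 1.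
    by rewrite det_mulmx t'1 // s1 ?mul1r //; apply: generated_mem.
  have [r1 r1t Hr1] := tP _ drx.
  have r1t' : r1 \in t' by rewrite inE r1t orbT.
  have [r' r't [h' Sh' e]] := IH r1 r1t'.
  exists r' => //; exists (r *m x *m \adj r1 *m h').
    right=> //; rewrite mem_filter asboolT // mem_cat -mulmxA; apply/orP; right.
    by apply: allpairs_f => //; apply: allpairs_f.
  rewrite -!mulmxA -e !mulmxA -(mulmxA _ (\adj r1)) adjmx_mul ?t1 //.
  by rewrite mulmx1.
exists S; split=> // g sg Hg.
have [r rt [h Sh]] := walk g sg 1%:M (mem_head _ _); rewrite mul1mx => gE.
have [dh Hh'] := HV h (genH _ Sh).
rewrite gE; apply: generated_mul => //; apply: generated_mem.
rewrite mem_filter mem_cat rt andbT; apply/asboolP.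
by have := HM _ _ Hh' Hg; rewrite gE mulmxA adjmx_mul // mul1mx.
Qed.

Section CongruenceSubgroup.
Variables (K : fieldExtType rat) (w : K) (D : nat).
Hypothesis genw : imaginary_generator w D.

(** For Q the condition of determinant 1 this bounds the index of a congruence
    subgroup; for Q the condition of determinant prime to l it makes the set of
    matrices acting modulo l finite. *)
Lemma matrix_residues (M : nat) (Q : 'M['O_K]_2 -> Prop) : (0 < M)%N ->
  exists t : seq 'M['O_K]_2, (forall r, r \in t -> Q r) /\
    forall g, Q g -> exists2 r, r \in t & exists y, g = r + M%:R *: y.
Proof.
move=> M0; have [res resP] := finitely_many_residues genw M0.
pose close m := [set r | Q r /\ exists y, r = m + M%:R *: y]%classic.
pose ms := [seq mx22 p.1 p.2 q.1 q.2 |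
  p <- [seq (x, y) | x <- res, y <- res], q <- [seq (x, y) | x <- res, y <- res]].
exists [seq r <- [seq xget 1%:M (close m) | m <- ms] | `[< Q r >]]; split.
  by move=> r; rewrite mem_filter => /andP[/asboolP].
move=> g Qg.
have [a ares [a' aE]] := resP (g 0 0); have [b bres [b' bE]] := resP (g 0 1).
have [c cres [c' cE]] := resP (g 1 0); have [d dres [d' dE]] := resP (g 1 1).
pose m := mx22 a b c d.
have gm : g = m + M%:R *: mx22 a' b' c' d'.
  rewrite [LHS]mx22E [RHS]mx22E aE bE cE dE.
  by congr mx22; rewrite !mxE.
have [Qr [y rE]] : close m (xget 1%:M (close m)).
  by apply: (xgetPex 1%:M); exists g; split=> //; exists (mx22 a' b' c' d').
exists (xget 1%:M (close m)).
  rewrite mem_filter asboolT //=; apply: map_f.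
  by apply: (@allpairs_f _ _ _ _ _ _ (a, b) (c, d)); apply: allpairs_f.
exists (mx22 a' b' c' d' - y).
by rewrite [in RHS]rE scalerBr addrACA subrr addr0 -gm.
Qed.

Variable a : {pred 'O_K}.

Definition integral_Gamma1 (g : 'M['O_K]_2) : Prop :=
  [/\ \det g = 1, g 1 0 \in a & g 1 1 - 1 \in a].

Hypothesis ideal_a : is_ideal a.
Hypothesis cl1 : class_number_one K.

Lemma integral_Gamma1_1 : integral_Gamma1 1%:M.
Proof. by case: ideal_a => a0 _ _; split; rewrite ?det1 // !mxE ?subrr. Qed.

Lemma integral_Gamma1M g h :
  integral_Gamma1 g -> integral_Gamma1 h -> integral_Gamma1 (g *m h).
Proof.
case: ideal_a => a0 aD aM [dg g10 g11] [dh h10 h11].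
split; first by rewrite det_mulmx dg dh mulr1.
  rewrite [g]mx22E [h]mx22E mul_mx22 mxE /=.
  by rewrite mulrC; apply: (aD); apply: (aM).
rewrite [g]mx22E [h]mx22E mul_mx22 mxE /=.
have -> : g 1 0 * h 0 1 + g 1 1 * h 1 1 - 1 =
  h 0 1 * g 1 0 + (g 1 1 * (h 1 1 - 1) + 1 * (g 1 1 - 1)) by ring.
by apply: (aD); [exact: aM | apply: (aD); exact: aM].
Qed.

Lemma integral_Gamma1V g : integral_Gamma1 g -> integral_Gamma1 (\adj g).
Proof.
case: ideal_a => a0 aD aM [dg g10 g11].
split; first by rewrite det_adj22.
  rewrite [g]mx22E adj_mx22 mxE /= -mulN1r; exact: aM.
rewrite [g]mx22E adj_mx22 mxE /=.
have -> : g 0 0 - 1 = g 0 1 * g 1 0 + (- g 0 0) * (g 1 1 - 1).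
  by move: dg; rewrite {1}[g]mx22E det_mx22 => {1}<-; ring.
by apply: (aD); exact: aM.
Qed.

(** The ideal contains the norm M of its nonzero element x.  Two matrices of
    determinant 1 that are congruent modulo M differ by an element of Gamma_1(a),
    which therefore has finite index. *)
Lemma Gamma1_finitely_generated : (exists2 x, x \in a & x != 0) ->
  exists s : seq 'M['O_K]_2, {in s, forall g, integral_Gamma1 g} /\
    forall g, integral_Gamma1 g -> generated s g.
Proof.
move=> [x xa x0].
have [_ _ aM] := ideal_a.
have [s [s1 sgen]] := SL2_finitely_generated genw cl1.
have [y Nxy] := divides_integer_norm genw x.
have M0 : (0 < integer_norm w D x)%N by rewrite lt0n (integer_norm_eq0 genw).
set M := integer_norm w D x in M0 Nxy.
have Ma z : M%:R * z \in a by rewrite Nxy -mulrA mulrC aM.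
have [t [t1 tP]] := matrix_residues (fun g => \det g = 1) M0.
have [S [SH Sgen]] : exists S : seq 'M['O_K]_2, (forall g, g \in S -> integral_Gamma1 g) /\
    forall g, generated s g -> integral_Gamma1 g -> generated S g.
  apply: (schreier (t := t)).
  - exact: t1.
  - exact: integral_Gamma1_1.
  - exact: integral_Gamma1M.
  - by move=> g Hg; split; [case: Hg | apply: integral_Gamma1V].
  - move=> g; elim=> [|z h zs _ dh]; first exact: det1.
    by rewrite det_mulmx (s1 _ zs) dh mulr1.
  - move=> g dg; have [r rt [z gE]] := tP g dg; exists r => //.
    have dr := t1 r rt.
    have -> : g *m \adj r = 1%:M + M%:R *: (z *m \adj r).
      by rewrite gE mulmxDl mulmx_adj // scalemxAl.
    split; rewrite ?mxE ?add0r //=.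
      have -> : 1%:M + M%:R *: (z *m \adj r) = g *m \adj r.
        by rewrite gE mulmxDl mulmx_adj // scalemxAl.
      by rewrite det_mulmx det_adj22 dg dr mulr1.
    by rewrite addrAC subrr add0r.
by exists S; split=> // g Hg; apply: Sgen => //; apply: sgen; case: Hg.
Qed.
End CongruenceSubgroup.

(** * Matrices over K with entries in O *)

Section IntegralMatrices.
Variable K : fieldExtType rat.
Implicit Types (g h : 'M['O_K]_2).

Definition emb g : 'M[K]_2 := map_mx val g.

Lemma embK g : mx_to_O (emb g) = g.
Proof. by rewrite /mx_to_O /emb -map_mx_comp map_mx_id // => x; apply: valKd. Qed.

Lemma emb_mxOver g : emb g \is a mxOver (@integer_pred K).
Proof. by apply/mxOverP=> i j; rewrite mxE; apply: valP. Qed.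

Lemma mxOver_emb (A : 'M[K]_2) : A \is a mxOver (@integer_pred K) -> A = emb (mx_to_O A).
Proof. by move/mxOverP=> AO; apply/matrixP=> i j; rewrite !mxE insubdK. Qed.

Lemma embM g h : emb (g *m h) = emb g *m emb h.
Proof. exact: map_mxM. Qed.

Lemma emb1 : emb 1%:M = 1%:M.
Proof. exact: map_mx1. Qed.

Lemma det_emb g : \det (emb g) = val (\det g).
Proof. exact: det_map_mx. Qed.

Lemma Gamma1_emb (a : {pred 'O_K}) g : emb g \in Gamma1 a <-> integral_Gamma1 a g.
Proof.
rewrite /in_mem /= /Gamma1 emb_mxOver embK det_emb.
split=> [/and4P[_ /eqP dg h1 h2]|[dg h1 h2]].
  by split=> //; apply: val_inj; rewrite dg rmorph1.
by apply/and4P; split=> //; rewrite dg rmorph1.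
Qed.

Lemma Gamma1P (a : {pred 'O_K}) (A : 'M[K]_2) : A \in Gamma1 a ->
  exists2 g, A = emb g & integral_Gamma1 a g.
Proof.
move=> AG; have AO : A \is a mxOver (@integer_pred K) by case/and4P: AG.
exists (mx_to_O A); first exact: mxOver_emb.
by apply/Gamma1_emb; rewrite -mxOver_emb.
Qed.

Lemma invmx_emb g : \det g = 1 -> invmx (emb g) = emb (\adj g).
Proof.
move=> dg; have u : emb g \in unitmx by rewrite unitmxE det_emb dg rmorph1 unitr1.
by rewrite -[RHS](mulKmx u) -embM mulmx_adj // emb1 mulmx1.
Qed.

Lemma mx_iota_emb g : \det g != 0 -> mx_iota (emb g) = emb (\adj g).
Proof.
move=> dg; have d0 : \det (emb g) != 0 by rewrite det_emb (inj_eq val_inj _ 0).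
have u : emb g \in unitmx by rewrite unitmxE unitfE.
rewrite -[RHS](mulKmx u) -embM mul_mx_adj /mx_iota det_emb -mul_mx_scalar.
by congr (_ *m _); rewrite /emb map_scalar_mx.
Qed.
End IntegralMatrices.

(** * Matrices of determinant prime to l and double cosets *)

Section GoodMatrices.
Variables (K : fieldExtType rat) (l : nat) (l_pr : prime l).
Implicit Types (g h : 'M['O_K]_2).

Definition coprime_to_l (x : 'O_K) : Prop := exists u v, x * u + l%:R * v = 1.

Lemma coprime_to_lM x y : coprime_to_l x -> coprime_to_l y -> coprime_to_l (x * y).
Proof.
move=> [u [v e]] [u' [v' e']]; exists (u * u'), (v + x * u * v').
have -> : x * y * (u * u') + l%:R * (v + x * u * v') =
  x * u * (y * u' + l%:R * v') + l%:R * v by ring.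
by rewrite e' mulr1.
Qed.

Lemma coprime_to_l_neq0 x : coprime_to_l x -> x != 0.
Proof.
move=> [u [v]]; apply: contra_eqN => /eqP->; rewrite mul0r add0r.
have [_ /negP l1 _] := l_ideal_closed K l_pr.
by apply/eqP=> e; apply: l1; apply/asboolP; exists v; rewrite mulrC.
Qed.

Definition good_prime (p : 'O_K) : Prop := prime_element p /\ coprime_to_l p.

(** These are the matrices of M_2(O) that act through GL_2(O/(l)). *)
Definition good_matrix (A : 'M[K]_2) : Prop :=
  exists2 g, A = emb g & coprime_to_l (\det g).

Lemma good_matrixM A B : good_matrix A -> good_matrix B -> good_matrix (A *m B).
Proof.
move=> [g -> dg] [h -> dh]; exists (g *m h); first by rewrite embM.
by rewrite det_mulmx; apply: coprime_to_lM.
Qed.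

Lemma Gamma1_good a A : A \in Gamma1 a -> good_matrix A.
Proof.
move=> /Gamma1P[g -> [dg _ _]]; exists g => //; exists 1, 0; rewrite dg; ring.
Qed.

Lemma good_matrix_M2O A : good_matrix A -> A \in @M2O K.
Proof.
move=> [g -> dg]; rewrite /in_mem /= /M2O emb_mxOver det_emb (inj_eq val_inj _ 0).
exact: coprime_to_l_neq0.
Qed.

Definition reduce_l (x : 'O_K) : residue_ring K l_pr :=
  \pi_{ideal_quot (l_ideal l_pr)}%qT x.

Fact reduce_l_zmod_morphism : zmod_morphism reduce_l.
Proof. by move=> x y; rewrite /reduce_l; apply: rmorphB. Qed.

Fact reduce_l_monoid_morphism : monoid_morphism reduce_l.
Proof. by split; [apply: rmorph1 | move=> x y; apply: rmorphM]. Qed.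

HB.instance Definition _ :=
  GRing.isZmodMorphism.Build _ _ reduce_l reduce_l_zmod_morphism.
HB.instance Definition _ :=
  GRing.isMonoidMorphism.Build _ _ reduce_l reduce_l_monoid_morphism.

Lemma mx_mod_l_emb g : mx_mod_l l_pr (emb g) = map_mx reduce_l g.
Proof. by rewrite /mx_mod_l embK. Qed.

Lemma reduce_l_multiple x : reduce_l (l%:R * x) = 0.
Proof.
rewrite -(rmorph0 reduce_l); apply/eqP; rewrite -Quotient.idealrBE subr0.
by apply/asboolP; exists x; rewrite mulrC.
Qed.

Lemma good_matrix_GL2 A : good_matrix A -> GL2 (mx_mod_l l_pr A).
Proof.
move=> [g -> [u [v e]]]; rewrite mx_mod_l_emb.
have red1 : map_mx reduce_l (u *: (\det g)%:M) = 1%:M :> 'M_2.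
  rewrite scale_scalar_mx map_scalar_mx mulrC; congr _%:M.
  by rewrite -(rmorph1 reduce_l) -e rmorphD /= reduce_l_multiple addr0.
exists (map_mx reduce_l (u *: \adj g)); rewrite -!map_mxM /=.
by rewrite -scalemxAr -scalemxAl mul_mx_adj mul_adj_mx.
Qed.

Lemma mx_mod_l_congr g h (y : 'M['O_K]_2) :
  g = h + l%:R *: y -> mx_mod_l l_pr (emb g) = mx_mod_l l_pr (emb h).
Proof.
move=> ->; rewrite !mx_mod_l_emb; apply/matrixP=> i j.
by rewrite !mxE rmorphD /= reduce_l_multiple addr0.
Qed.

(** Finiteness of O/(l), for matrices. *)
Lemma good_matrix_representatives (w : K) (D : nat) : imaginary_generator w D ->
  exists (n : nat) (t : 'I_n -> 'M[K]_2), (forall i, good_matrix (t i)) /\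
    forall A, good_matrix A -> exists i, mx_mod_l l_pr A = mx_mod_l l_pr (t i).
Proof.
move=> genw.
have [t [tQ tP]] := matrix_residues genw (fun g => coprime_to_l (\det g)) (prime_gt0 l_pr).
exists (size t), (fun i => emb (tnth (in_tuple t) i)); split=> [i|_ [g -> dg]].
  by exists (tnth (in_tuple t) i) => //; apply: tQ; apply: mem_tnth.
have [r rt [y gE]] := tP g dg.
have /tnthP[i ri] : r \in in_tuple t by [].
by exists i; rewrite -ri; apply: mx_mod_l_congr gE.
Qed.

Variable a : {pred 'O_K}.

Hypothesis ideal_a : is_ideal a.

Lemma Gamma1_1 : 1%:M \in Gamma1 a.
Proof. by rewrite -emb1; apply/Gamma1_emb/integral_Gamma1_1. Qed.

Lemma Gamma1M A B : A \in Gamma1 a -> B \in Gamma1 a -> A *m B \in Gamma1 a.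
Proof.
move=> /Gamma1P[g -> gG] /Gamma1P[h -> hG]; rewrite -embM.
by apply/Gamma1_emb/integral_Gamma1M.
Qed.

Lemma Gamma1V A : A \in Gamma1 a -> A \in unitmx /\ invmx A \in Gamma1 a.
Proof.
move=> /Gamma1P[g -> gG]; have [dg _ _] := gG.
split; first by rewrite unitmxE det_emb dg rmorph1 unitr1.
by rewrite invmx_emb //; apply/Gamma1_emb/integral_Gamma1V.
Qed.

Lemma pi_tilde_emb (p : 'O_K) : pi_tilde p = emb (mx22 p 0 0 1).
Proof.
rewrite [LHS]mx22E [RHS]mx22E; congr mx22; rewrite !mxE //=; rewrite ?rmorph0 ?rmorph1 //.
Qed.

Lemma double_coset_emb p A : double_coset a p A -> exists2 g, A = emb g & \det g = p.
Proof.
move=> [_ [_ [/Gamma1P[g -> [dg _ _]] /Gamma1P[h -> [dh _ _]] ->]]].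
exists (g *m mx22 p 0 0 1 *m h); first by rewrite !embM pi_tilde_emb.
by rewrite !det_mulmx dg dh det_mx22; ring.
Qed.

Lemma double_cosetM p A B :
  A \in Gamma1 a -> double_coset a p B -> double_coset a p (A *m B).
Proof.
move=> AG [g [h [gG hG ->]]]; exists (A *m g), h.
by rewrite !mulmxA; split=> //; apply: Gamma1M.
Qed.

(** Without a finite decomposition of the double coset the list is empty, and T_p is
    zero. *)
Variant coset_reps_spec p : seq 'M[K]_2 -> Prop :=
| NoCosetReps : coset_reps_spec p [::]
| CosetReps s of coset_decomposition a p s : coset_reps_spec p s.

Lemma coset_repsP p : coset_reps_spec p (coset_reps a p).
Proof. by rewrite /coset_reps; case: xgetP => [s _ sP|_]; constructor. Qed.

Lemma coset_decomposition_mem p s A : coset_decomposition a p s -> A \in s ->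
  double_coset a p A.
Proof.
case=> _ sP _ As; apply/sP; exists A => //.
by exists 1%:M; rewrite ?mulmx1 //; apply: Gamma1_1.
Qed.

Lemma coset_reps_emb p A : A \in coset_reps a p -> exists2 g, A = emb g & \det g = p.
Proof.
case: coset_repsP => // s sP As.
exact: double_coset_emb (coset_decomposition_mem sP As).
Qed.

Lemma coset_reps_iota_good p A : coprime_to_l p -> A \in coset_reps a p ->
  good_matrix (mx_iota A).
Proof.
move=> pl /coset_reps_emb[g -> dg].
rewrite mx_iota_emb ?dg; last exact: coprime_to_l_neq0.
by exists (\adj g); rewrite ?det_adj22 ?dg.
Qed.

Lemma coset_reps_unit p A : p != 0 -> A \in coset_reps a p -> A \in unitmx.
Proof.
move=> p0 /coset_reps_emb[g -> dg].
by rewrite unitmxE det_emb dg unitfE (inj_eq val_inj _ 0).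
Qed.

(** Left multiplication by B permutes the cosets gamma Gamma_1(a) of the double
    coset. *)
Lemma coset_reps_permuted p B A : p != 0 -> B \in Gamma1 a -> A \in coset_reps a p ->
  exists2 A', A' \in coset_reps a p &
    forall C, C \in coset_reps a p -> (invmx C *m B *m A \in Gamma1 a) = (C == A').
Proof.
move=> p0 BG; have uc C := @coset_reps_unit p C p0.
case: coset_repsP uc => // s sP uc As; have [us sE sdisj] := sP.
have BA : double_coset a p (B *m A).
  exact: double_cosetM (coset_decomposition_mem sP As).
have [A' A's [h hG e]] := (sE _).1 BA.
exists A' => // C Cs; apply/idP/eqP => [CG|->].
  apply: (sdisj _ _ Cs A's _ _ CG hG).
  by rewrite -e !mulmxA mulmxV ?mul1mx ?uc.
by rewrite -mulmxA e mulKmx ?uc.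
Qed.

Lemma invmx_mul (A B : 'M[K]_2) : A \in unitmx -> B \in unitmx ->
  invmx (A *m B) = invmx B *m invmx A.
Proof. exact: invrM. Qed.

(** The inverse of the permutation induced by B is the one induced by its inverse. *)
Lemma coset_reps_permuted_inv p B A : p != 0 -> B \in Gamma1 a -> A \in coset_reps a p ->
  exists2 A', A' \in coset_reps a p &
    forall C, C \in coset_reps a p -> (invmx A *m B *m C \in Gamma1 a) = (C == A').
Proof.
move=> p0 BG As; have [uB BVG] := Gamma1V BG.
have [A' A's A'P] := coset_reps_permuted p0 BVG As; exists A' => // C Cs.
rewrite -A'P //; have uA := coset_reps_unit p0 As; have uC := coset_reps_unit p0 Cs.
have e : invmx (invmx A *m B *m C) = invmx C *m invmx B *m A.
  by rewrite !invmx_mul ?invmxK ?mulmxA // ?unitmx_mul ?unitmx_inv ?uA.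
have e' : invmx (invmx C *m invmx B *m A) = invmx A *m B *m C.
  by rewrite -e invmxK.
by apply/idP/idP => /Gamma1V[_]; rewrite ?e ?e'.
Qed.

Lemma big_unique (V : zmodType) (T : eqType) (s : seq T) (P : pred T) (F : T -> V) x :
  uniq s -> x \in s -> (forall y, y \in s -> P y = (y == x)) ->
  \sum_(y <- s | P y) F y = F x.
Proof.
move=> us xs Px; rewrite big_mkcond (bigD1_seq x) //= Px // eqxx big_seq_cond big1 ?addr0 //.
by move=> y /andP[ys yx]; rewrite Px // (negPf yx).
Qed.
End GoodMatrices.

(** * Hecke operators *)

Section HeckeOperators.
Variables (K : fieldExtType rat) (a : {pred 'O_K}).

(** The action is a parameter because the operator is applied to a coefficient module
    and to a permutation module that covers its cyclic subquotients. *)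
Definition hecke_op (V : zmodType) (act : 'M[K]_2 -> V -> V) (p : 'O_K)
    (c : 'M[K]_2 -> V) : 'M[K]_2 -> V := fun g =>
  \sum_(A <- coset_reps a p)
    \sum_(A' <- coset_reps a p | invmx A' *m g *m A \in Gamma1 a)
      act (mx_iota A) (c (invmx A' *m g *m A)).

Variable l : nat.
Hypothesis ideal_a : is_ideal a.

(** A Hecke operator is made of sums and of the action of good matrices, so it
    preserves every relation compatible with these.  Congruence modulo a submodule is
    such a relation, and so is the correspondence along an equivariant map. *)
Lemma hecke_op_rel (l_pr : prime l) (V1 V2 : zmodType)
    (act1 : 'M[K]_2 -> V1 -> V1) (act2 : 'M[K]_2 -> V2 -> V2) (Q : V1 -> V2 -> Prop)
    (p : 'O_K) c1 c2 :
  Q 0 0 -> (forall x1 x2 y1 y2, Q x1 x2 -> Q y1 y2 -> Q (x1 + y1) (x2 + y2)) ->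
  (forall A x1 x2, good_matrix l A -> Q x1 x2 -> Q (act1 A x1) (act2 A x2)) ->
  coprime_to_l l p ->
  {in Gamma1 a, forall g, Q (c1 g) (c2 g)} ->
  {in Gamma1 a, forall g, Q (hecke_op act1 p c1 g) (hecke_op act2 p c2 g)}.
Proof.
move=> Q0 QD Qact pl Qc g gG; rewrite /hecke_op.
rewrite big_seq_cond [X in Q _ X]big_seq_cond.
apply: (big_ind2 Q) => // A; rewrite andbT => As.
apply: (big_ind2 Q) => // A' A'G.
by apply: Qact; [apply: (coset_reps_iota_good l_pr ideal_a pl As) | apply: Qc].
Qed.
End HeckeOperators.

(** * Eigenclasses in a finite module *)

Section FiniteCode.
Variables (K : fieldExtType rat) (a : {pred 'O_K}) (l : nat) (l_pr : prime l).
Hypothesis ideal_a : is_ideal a.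
Variables (k : nat) (s : 'I_k -> 'M[K]_2).
Hypothesis s_Gamma : forall i, s i \in Gamma1 a.
Hypothesis s_gen : forall P : 'M[K]_2 -> Prop, P 1%:M ->
  (forall i g, g \in Gamma1 a -> P g -> P (s i *m g)) -> forall g, g \in Gamma1 a -> P g.
Variables (n : nat) (rho : 'M[K]_2 -> 'M['F_l]_n).
Local Notation M := 'rV['F_l]_n.
Local Notation T := (hecke_op a (fun A (x : M) => x *m rho A)).
Implicit Types (W : M -> Prop) (c d : 'M[K]_2 -> M) (B : ('M[K]_2 -> M) -> Prop).

Definition cocycle_mod W c : Prop :=
  {in Gamma1 a &, forall g h, W (c (g *m h) - (c g *m rho h + c h))}.

(** Here rho is only a choice of representatives: the identity matrix acts as the
    identity modulo W, but possibly not on M itself. *)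
Record submodule W : Prop := Submodule {
  submod0 : W 0;
  submodB : forall x y, W x -> W y -> W (x - y);
  submodZ : forall u x, W x -> W (u *: x);
  submod1 : forall x, W (x *m rho 1%:M - x);
  submod_act : forall A x, good_matrix l A -> W x -> W (x *m rho A) }.

Lemma submodD W x y : submodule W -> W x -> W y -> W (x + y).
Proof.
move=> sW Wx Wy; rewrite -[y]opprK -[- y]sub0r.
by do !apply: (submodB sW) => //; apply: submod0.
Qed.

(** Induction on words in the generators, by the cocycle relation. *)
Lemma cocycle_mod_eq W c d : submodule W -> cocycle_mod W c -> cocycle_mod W d ->
  (forall i, W (c (s i) - d (s i))) -> {in Gamma1 a, forall g, W (c g - d g)}.
Proof.
move=> sW Wc Wd cd; apply: s_gen => [|i g gG Wg].
  have G1 := Gamma1_1 ideal_a.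
  have := submodB sW (Wd _ _ G1 G1) (Wc _ _ G1 G1); rewrite mulmx1.
  set x := c _; set y := d _ => h.
  have -> : x - y = (y - (y *m rho 1%:M + y) - (x - (x *m rho 1%:M + x))) -
                    ((x - y) *m rho 1%:M - (x - y)).
    rewrite mulmxBl; move: (x *m _) (y *m _) => u v.
    by apply/rowP=> i; rewrite !mxE; ring.
  by apply: (submodB sW) => //; apply: submod1 sW _.
have := submodB sW (Wc _ _ (s_Gamma i) gG) (Wd _ _ (s_Gamma i) gG) => h.
have := submod_act sW (Gamma1_good l gG) (cd i); rewrite mulmxBl => h'.
have := submodD sW h (submodD sW h' Wg).
move: (c (s i *m g)) (d (s i *m g)) (c (s i) *m _) (d (s i) *m _) => x y u v.
by congr W; apply/rowP=> j; rewrite !mxE; ring.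
Qed.

(** What an eigenclass leaves in the finite module M: the quotient M / W stands for a
    cyclic subquotient U' / U of the coefficients, c for a cocycle with values in it,
    and B for the space of cocycles that become coboundaries in the larger module
    E / U.  Modulo B, the cocycle c is a nonzero eigenvector. *)
Record realised (chi : 'O_K -> 'F_l) W c B : Prop := Realised {
  real_W : submodule W;
  real_c : cocycle_mod W c;
  real_Bcocycle : forall d, B d -> cocycle_mod W d;
  real_B : forall d d' u, B d -> B d' -> B (fun g => u *: (d g - d' g));
  real_Bcongr : forall d d', B d -> {in Gamma1 a, forall g, W (d g - d' g)} -> B d';
  real_nontrivial : ~ B c;
  real_eigen : forall p, good_prime l p -> B (fun g => T p c g - chi p *: c g) }.

Definition code_type : finType :=
  ({set M} * {ffun 'I_k -> M} * {set {ffun 'I_k -> M}})%type.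

Definition restrict_gens d : {ffun 'I_k -> M} := [ffun i => d (s i)].

Definition code W c B : code_type :=
  ([set x | `[< W x >]], restrict_gens c,
   [set f | `[< exists2 d, B d & restrict_gens d = f >]]).

(** The code recovers c modulo W and B, because cocycles are determined by their
    values on the generators.  If two eigenvalues of T_p differed, the difference of
    the two eigenvector relations would put a nonzero multiple of c in B. *)
Lemma code_determines chi1 chi2 W1 W2 c1 c2 B1 B2 :
  realised chi1 W1 c1 B1 -> realised chi2 W2 c2 B2 -> code W1 c1 B1 = code W2 c2 B2 ->
  forall p, good_prime l p -> chi1 p = chi2 p.
Proof.
move=> R1 R2 [eW ec eB] p pl.
have W12 x : W1 x <-> W2 x.
  have /setP/(_ x) := eW; rewrite !inE => e.
  by split=> /asboolP; [rewrite e | rewrite -e] => /asboolP.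
have sW := real_W R1.
have c12 : {in Gamma1 a, forall g, W1 (c1 g - c2 g)}.
  apply: cocycle_mod_eq => //; first exact: real_c R1.
    by move=> g h gG hG; apply/W12; apply: (real_c R2).
  by move=> i; have /ffunP/(_ i) := ec; rewrite !ffunE => ->; rewrite subrr; apply: submod0.
have Td : {in Gamma1 a, forall g, W1 (T p c1 g - T p c2 g)}.
  apply: (hecke_op_rel ideal_a l_pr (Q := fun x y => W1 (x - y))) c12 => //; last exact: pl.2.
  - by rewrite subrr; apply: submod0.
  - by move=> x1 x2 y1 y2 h1 h2; rewrite opprD addrACA; apply: submodD.
  - by move=> A x1 x2 gA h; rewrite -mulmxBl; apply: (submod_act sW).
pose d2 g := T p c2 g - chi2 p *: c2 g.
have [d2' Bd2' ed2] : exists2 d, B1 d & restrict_gens d = restrict_gens d2.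
  have : restrict_gens d2 \in (code W2 c2 B2).2.
    by rewrite inE; apply/asboolP; exists d2 => //; exact: (real_eigen R2 pl).
  by rewrite /= -eB inE => /asboolP.
have gens i : d2' (s i) = d2 (s i) by have /ffunP/(_ i) := ed2; rewrite !ffunE.
have d2'd2 : {in Gamma1 a, forall g, W1 (d2' g - d2 g)}.
  apply: cocycle_mod_eq => //; first exact: real_Bcocycle R1 _ Bd2'.
    by move=> g h gG hG; apply/W12; apply: (real_Bcocycle R2 (real_eigen R2 pl)).
  by move=> i; rewrite gens subrr; apply: submod0.
have Bd1 := real_eigen R1 pl.
have B1d2 : B1 (fun g => T p c1 g - chi2 p *: c1 g).
  apply: (real_Bcongr R1 Bd2') => g gG.
  have h := submodB sW (d2'd2 g gG) (submodB sW (Td g gG) (submodZ sW (chi2 p) (c12 g gG))).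
  by move: h; rewrite /d2; congr W1; apply/rowP=> i; rewrite !mxE; ring.
apply/eqP/negPn/negP => chi12; apply: (real_nontrivial R1).
have := real_B R1 (chi2 p - chi1 p)^-1 Bd1 B1d2.
congr B1; apply/funext=> g.
have -> : T p c1 g - chi1 p *: c1 g - (T p c1 g - chi2 p *: c1 g) =
    (chi2 p - chi1 p) *: c1 g.
  by move: (T p c1 g) => x; apply/rowP=> i; rewrite !mxE; ring.
by rewrite scalerA mulVf ?scale1r // subr_eq0 eq_sym.
Qed.
End FiniteCode.

(** * Reduction to cyclic coefficient modules *)

Import VectorInternalTheory.

(** Linear identities are checked on coordinates. *)
Ltac lmod_ring := apply: v2r_inj; rewrite !(linearD, linearN, linearZ) /=;
  apply/rowP=> ?; rewrite !mxE; ring.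

Section Reduction.
Variables (K : fieldExtType rat) (a : {pred 'O_K}) (l : nat) (l_pr : prime l).
Hypothesis ideal_a : is_ideal a.
Variables (E : vectType 'F_l) (act : 'M[K]_2 -> 'End(E)).
Hypothesis act1 : act 1%:M = \1%VF.
Hypothesis actM : forall A B, good_matrix l A -> good_matrix l B ->
  act (A *m B) = (act B \o act A)%VF.
Hypothesis act_congr : forall A B, good_matrix l A -> good_matrix l B ->
  mx_mod_l l_pr A = mx_mod_l l_pr B -> act A = act B.
Local Notation T := (hecke_op a (fun A (x : E) => act A x)).

Definition cobound (e : E) : 'M[K]_2 -> E := fun A => act A e - e.

Lemma coboundD e1 e2 A : cobound (e1 + e2) A = cobound e1 A + cobound e2 A.
Proof. by rewrite /cobound linearD opprD addrACA. Qed.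

Lemma coboundZ u e A : cobound (u *: e) A = u *: cobound e A.
Proof. by rewrite /cobound linearZ scalerBr. Qed.

Lemma coboundN e A : cobound (- e) A = - cobound e A.
Proof. by rewrite /cobound linearN opprB opprK addrC. Qed.

Lemma cobound_cocycle e A B : good_matrix l A -> good_matrix l B ->
  cobound e (A *m B) = act B (cobound e A) + cobound e B.
Proof.
move=> gA gB; rewrite /cobound actM // lfunE /= linearB /=.
move: (act B (act A e)) (act B e) => x y; lmod_ring.
Qed.

Lemma hecke_opB p c d g : T p (fun x => c x - d x) g = T p c g - T p d g.
Proof.
rewrite /hecke_op -sumrB; apply: eq_bigr => A _; rewrite -sumrB.
by apply: eq_bigr => A' _; rewrite linearB.
Qed.

(** The relation gamma'^-1 g gamma gamma^iota = gamma'^iota g turns the term of index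
    gamma into a difference of terms indexed by gamma' and gamma, and gamma' runs
    through the representatives as gamma does. *)
Lemma hecke_cobound p e g : coprime_to_l l p -> g \in Gamma1 a ->
  T p (cobound e) g = cobound (\sum_(A <- coset_reps a p) act (mx_iota A) e) g.
Proof.
move=> pl gG; have p0 := coprime_to_l_neq0 l_pr pl.
have uniq_reps : uniq (coset_reps a p) by case: coset_repsP => // s [].
have good_iota A : A \in coset_reps a p -> good_matrix l (mx_iota A).
  exact: coset_reps_iota_good.
have term A A' : A \in coset_reps a p -> A' \in coset_reps a p ->
    invmx A' *m g *m A \in Gamma1 a ->
    act (mx_iota A) (cobound e (invmx A' *m g *m A)) =
    act g (act (mx_iota A') e) - act (mx_iota A) e.
  move=> As A's xG; rewrite /cobound linearB /=; congr (_ - _).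
  have gx := Gamma1_good l xG; have gg := Gamma1_good l gG.
  rewrite -!comp_lfunE -!actM //; try exact: good_iota.
  have [h AE dh] := coset_reps_emb ideal_a As.
  have [h' A'E dh'] := coset_reps_emb ideal_a A's.
  congr (fun_of_lfun (act _) e).
  rewrite AE A'E !mx_iota_emb ?dh ?dh' //.
  have u' : emb h' \in unitmx by rewrite -A'E (coset_reps_unit ideal_a p0).
  rewrite -[RHS](mulKmx u') -!mulmxA; congr (_ *m _).
  rewrite (mulmxA (emb h')) -!embM !mul_mx_adj dh dh' /emb map_scalar_mx.
  by rewrite scalar_mxC.
rewrite /hecke_op.
transitivity (\sum_(A <- coset_reps a p)
    \sum_(A' <- coset_reps a p | invmx A' *m g *m A \in Gamma1 a)
      (act g (act (mx_iota A') e) - act (mx_iota A) e)).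
  rewrite big_seq [RHS]big_seq; apply: eq_bigr => A As.
  rewrite big_seq_cond [RHS]big_seq_cond; apply: eq_bigr => A' /andP[A's xG].
  exact: term.
under eq_bigr do rewrite sumrB.
rewrite sumrB /cobound; congr (_ - _).
  (* For fixed A' there is exactly one A satisfying the condition, and conversely. *)
  rewrite linear_sum /= (exchange_big_dep xpredT) //=.
  rewrite big_seq [RHS]big_seq; apply: eq_bigr => A' A's.
  have [A As AP] := coset_reps_permuted_inv ideal_a p0 gG A's.
  exact: (big_unique (fun=> act g (act (mx_iota A') e)) uniq_reps As).
rewrite big_seq [RHS]big_seq; apply: eq_bigr => A As.
have [A' A's A'P] := coset_reps_permuted ideal_a p0 gG As.
exact: (big_unique (fun=> act (mx_iota A) e) uniq_reps A's).
Qed.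

Lemma eq_memv (U : {vspace E}) x y : x = y -> x \in U -> y \in U.
Proof. by move=> ->. Qed.

Variables (n : nat) (t : 'I_n -> 'M[K]_2).
Hypothesis t_good : forall i, good_matrix l (t i).
Hypothesis t_cover : forall A, good_matrix l A ->
  exists i, mx_mod_l l_pr A = mx_mod_l l_pr (t i).

Definition right_translate A (i : 'I_n) : 'I_n :=
  xget i [set j | mx_mod_l l_pr (t i *m A) = mx_mod_l l_pr (t j)]%classic.

(** The permutation module spanned by the residue classes of the good matrices. *)
Definition translation_mx (A : 'M[K]_2) : 'M['F_l]_n :=
  \matrix_(i, j) (j == right_translate A i)%:R.

(** The presentation of the cyclic module generated by e as a quotient of the
    permutation module. *)
Definition orbit_map (e : E) (x : 'rV['F_l]_n) : E := \sum_i x 0 i *: act (t i) e.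

Fact orbit_map_linear e : linear (orbit_map e).
Proof.
move=> u x y; rewrite /orbit_map scaler_sumr -big_split /=.
by apply: eq_bigr => i _; rewrite !mxE scalerDl scalerA.
Qed.
HB.instance Definition _ e :=
  GRing.isLinear.Build _ _ _ _ (orbit_map e) (orbit_map_linear e).

Lemma orbit_mapB e x y : orbit_map e (x - y) = orbit_map e x - orbit_map e y.
Proof. exact: linearB. Qed.

Lemma orbit_mapD e x y : orbit_map e (x + y) = orbit_map e x + orbit_map e y.
Proof. exact: linearD. Qed.

Lemma orbit_mapZ e u x : orbit_map e (u *: x) = u *: orbit_map e x.
Proof. exact: linearZ. Qed.

Lemma orbit_map_delta e i : orbit_map e (delta_mx 0 i) = act (t i) e.
Proof.
rewrite /orbit_map (bigD1 i) //= mxE !eqxx scale1r big1 ?addr0 // => j ji.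
by rewrite mxE (negPf ji) andbF scale0r.
Qed.

(** The action of a good matrix on e depends only on its residue class. *)
Lemma orbit_map_act e A x : good_matrix l A ->
  orbit_map e (x *m translation_mx A) = act A (orbit_map e x).
Proof.
move=> gA; rewrite /orbit_map linear_sum /=.
have right_translateP i : act (t (right_translate A i)) e = act A (act (t i) e).
  have gi := t_good i.
  have /(xgetPex i) e' : exists j, mx_mod_l l_pr (t i *m A) = mx_mod_l l_pr (t j).
    by apply: t_cover; apply: good_matrixM.
  rewrite -comp_lfunE -actM //; congr (fun_of_lfun _ e).
  by apply: act_congr; [exact: t_good | exact: good_matrixM | rewrite -e'].
under eq_bigr => j _ do rewrite mxE scaler_suml.
rewrite exchange_big /=; apply: eq_bigr => i _.
rewrite (bigD1 (right_translate A i)) //= mxE eqxx mulr1 right_translateP linearZ.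
by rewrite big1 ?addr0 // => j ji; rewrite mxE (negPf ji) mulr0 scale0r.
Qed.

Lemma good_matrix1 : good_matrix l (1%:M : 'M[K]_2).
Proof. by apply: Gamma1_good; apply: Gamma1_1 ideal_a. Qed.

Definition stable (U : {vspace E}) : Prop :=
  forall A x, good_matrix l A -> x \in U -> act A x \in U.

(** The class of c in the cohomology of E / U is a nonzero eigenvector of the Hecke
    operators away from l.  Cochains with values in E, taken modulo U, replace the
    cochains of the quotient. *)
Definition eigenclass_mod (U : {vspace E}) (chi : 'O_K -> 'F_l) (c : 'M[K]_2 -> E) :=
  [/\ {in Gamma1 a &, forall g h, c (g *m h) = act h (c g) + c h},
      ~ (exists e, {in Gamma1 a, forall g, c g - cobound e g \in U})
    & forall p, good_prime l p -> exists e,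
        {in Gamma1 a, forall g, T p c g - chi p *: c g - cobound e g \in U}].

(** The cocycle c minus the coboundary of e0 has values in the sum of U and the cyclic
    module generated by e, so modulo U it lifts to a cochain c' of the permutation
    module.  W is the preimage of U, and B consists of the cochains whose image is a
    coboundary in E / U: the eigenvector relation modulo U then becomes the membership
    of T_p c' - chi(p) c' in B. *)
Lemma realised_cyclic U chi c e e0 : stable U -> eigenclass_mod U chi c ->
  {in Gamma1 a, forall g, exists x, c g - cobound e0 g - orbit_map e x \in U} ->
  exists W c' B, realised a translation_mx chi W c' B.
Proof.
move=> stU [cocy nontriv eig] c_lift.
pose W x := orbit_map e x \in U.
have [c' c'P] : exists c' : 'M[K]_2 -> 'rV['F_l]_n,
    {in Gamma1 a, forall g, c g - cobound e0 g - orbit_map e (c' g) \in U}.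
  exists (fun g => xget 0 [set x | c g - cobound e0 g - orbit_map e x \in U]%classic).
  by move=> g /c_lift /(xgetPex 0).
pose B (d : 'M[K]_2 -> 'rV['F_l]_n) :=
  exists e1, {in Gamma1 a, forall g, orbit_map e (d g) - cobound e1 g \in U}.
have sW : submodule translation_mx W.
  split; rewrite /W.
  - by rewrite linear0 mem0v.
  - by move=> x y xU yU; rewrite orbit_mapB memvB.
  - by move=> u x xU; rewrite orbit_mapZ memvZ.
  - move=> x; rewrite orbit_mapB orbit_map_act; last exact: good_matrix1.
    by rewrite act1 lfunE /= subrr mem0v.
  - by move=> A x gA xU; rewrite orbit_map_act // stU.
have good g : g \in Gamma1 a -> good_matrix l g by apply: Gamma1_good.
have lift_cocycle (b : 'M[K]_2 -> E) d :
    {in Gamma1 a &, forall g h, b (g *m h) = act h (b g) + b h} ->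
    {in Gamma1 a, forall g, orbit_map e (d g) - b g \in U} ->
    cocycle_mod a translation_mx W d.
  move=> bcoc db g h gG hG; rewrite /W orbit_mapB orbit_mapD orbit_map_act; last exact: good.
  have h1 := db _ (Gamma1M ideal_a gG hG); rewrite bcoc // in h1.
  have h2 := stU _ _ (good _ hG) (db _ gG); rewrite linearB /= in h2.
  have h3 := memvB h1 (memvD h2 (db _ hG)).
  move: h3; move: (orbit_map e (d (g *m h))) (act h (b g)) (b h)
    (act h (orbit_map e _)) (orbit_map e _) => x y z u v.
  by apply: eq_memv; lmod_ring.
have cob_cocycle (e1 : E) : {in Gamma1 a &, forall g h,
    cobound e1 (g *m h) = act h (cobound e1 g) + cobound e1 h}.
  by move=> g h gG hG; apply: cobound_cocycle; apply: good.
exists W, c', B; split=> //.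
- apply: (@lift_cocycle (fun g => c g - cobound e0 g)).
    move=> g h gG hG /=; rewrite cocy // cob_cocycle // [X in _ = X + _]linearB /=.
    by move: (act h (c g)) (act h (cobound e0 g)) (c h) (cobound e0 h) => x y z u; lmod_ring.
  by move=> g gG; rewrite -memvN opprB; apply: c'P.
- by move=> d [e1 de1]; apply: (@lift_cocycle (cobound e1)).
- move=> d d' u [e1 h1] [e2 h2]; exists (u *: (e1 - e2)) => g gG.
  have := memvZ u (memvB (h1 _ gG) (h2 _ gG)).
  rewrite coboundZ coboundD coboundN orbit_mapZ orbit_mapB.
  move: (orbit_map _ _) (orbit_map _ _) (cobound _ _) (cobound _ _) => x y z v.
  by apply: eq_memv; lmod_ring.
- move=> d d' [e1 h1] dd'; exists e1 => g gG.
  have := memvB (h1 _ gG) (dd' _ gG); rewrite orbit_mapB.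
  by apply: eq_memv; move: (orbit_map _ _) (orbit_map _ _) (cobound _ _) => x y z; lmod_ring.
- move=> [e1 h1]; apply: nontriv; exists (e0 + e1) => g gG.
  have := memvD (c'P _ gG) (h1 _ gG); rewrite coboundD.
  move: (orbit_map _ _) (cobound _ _) (cobound _ _) (c g) => x y z u.
  by apply: eq_memv; lmod_ring.
- move=> p pg; have [e2 h2] := eig p pg; have [_ pl] := pg.
  exists (e2 - \sum_(A <- coset_reps a p) act (mx_iota A) e0 + chi p *: e0) => g gG.
  have Trel : {in Gamma1 a, forall g,
      orbit_map e (hecke_op a (fun A (x : 'rV_n) => x *m translation_mx A) p c' g) -
      T p (fun g => c g - cobound e0 g) g \in U}.
    apply: (hecke_op_rel ideal_a l_pr (Q := fun x y => orbit_map e x - y \in U)) => //.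
    + by rewrite linear0 subrr mem0v.
    + move=> x1 x2 y1 y2 k1 k2; have := memvD k1 k2; rewrite orbit_mapD.
      by apply: eq_memv; move: (orbit_map _ _) (orbit_map _ _) => z v; lmod_ring.
    + by move=> A x y gA xy; rewrite orbit_map_act // -linearB /= stU.
    + by move=> h hG; rewrite -memvN opprB; apply: c'P.
  have h3 := memvD (memvD (Trel g gG) (h2 _ gG)) (memvZ (chi p) (c'P _ gG)).
  move: h3; rewrite hecke_opB hecke_cobound // !coboundD coboundN coboundZ.
  rewrite orbit_mapB orbit_mapZ.
  move: (orbit_map _ _) (orbit_map _ _) (T _ _ _).
  move: (cobound _ _) (cobound _ _) (cobound _ _) (c g).
  by move=> x y z u v b b'; apply: eq_memv; lmod_ring.
Qed.

(** Dévissage: enlarge U by one cyclic module at a time, until the class dies; the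
    class then comes from the last cyclic quotient. *)
Lemma eigenclass_realised U chi c : stable U -> eigenclass_mod U chi c ->
  exists W c' B, realised a translation_mx chi W c' B.
Proof.
have [m] := ubnP (\dim {:E} - \dim U); elim: m U => // m IH U Um stU eigc.
have [[e eU]|/forallNP all_in] := pselect (exists e, e \notin U); last first.
  case: eigc => _ nontriv _; case: nontriv; exists 0 => g _.
  exact/negPn/negP/all_in.
pose U' := (U + (linfun (orbit_map e) @: fullv))%VS.
have U'P x : reflect (exists y, x - orbit_map e y \in U) (x \in U').
  apply: (iffP memv_addP) => [[u uU [_ /memv_imgP[y _ ->] ->]]|[y xyU]].
    by exists y; rewrite lfunE /= addrK.
  exists (x - orbit_map e y) => //; exists (orbit_map e y); last by rewrite subrK.
  by rewrite -[orbit_map e y]lfunE memv_img ?memvf.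
have stU' : stable U'.
  move=> A x gA /U'P[y xyU]; apply/U'P; exists (y *m translation_mx A).
  by rewrite orbit_map_act // -linearB /= stU.
have eU' : e \in U'.
  have [i ti] := t_cover good_matrix1; apply/U'P; exists (delta_mx 0 i).
  rewrite orbit_map_delta -(act_congr good_matrix1 (t_good i) ti) act1 lfunE /=.
  by rewrite subrr mem0v.
have ltU : (\dim U < \dim U')%N.
  rewrite ltn_neqAle dimvS ?addvSl // andbT; apply: contra eU => /eqP dimU.
  by have /eqP-> : U == U' by rewrite eqEdim addvSl dimU leqnn.
have [[e0 e0P]|nontriv] :=
  pselect (exists e0, {in Gamma1 a, forall g, c g - cobound e0 g \in U'}).
  by apply: (realised_cyclic (e := e) (e0 := e0) stU eigc) => g /e0P /U'P.
apply: (IH U') => //.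
  have := dimvS (subvf U'); lia.
case: eigc => cocy _ eig; split=> // p /eig[e1 h1]; exists e1 => g /h1.
by apply: subvP; apply: addvSl.
Qed.
End Reduction.

(** * Eigenvalue systems *)

Section HeckeRing.
Variable K : fieldExtType rat.

Definition hecke_symbol (p : prime_elt K) : hecke_ring K := << ucm p >>.

(** The symbols T_pi generate the Hecke ring. *)
Lemma hecke_ring_morphism_eq (R : nzRingType) (f g : {rmorphism hecke_ring K -> R}) :
  (forall p, f (hecke_symbol p) = g (hecke_symbol p)) -> f =1 g.
Proof.
move=> fg.
have fgM x y : f x = g x -> f y = g y -> f (x * y) = g (x * y).
  by move=> fx fy; rewrite (rmorphM f) (rmorphM g) fx fy.
pose mono m : hecke_ring K := << m >>.
have mon (m : {cmonom (prime_elt K)}) : f (mono m) = g (mono m).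
  have [k] := ubnP (mdeg m); elim: k m => // k IH m mk.
  have [[p mp]|/forallNP m0] := pselect (exists p, m p != 0%N); last first.
    have -> : m = mone.
      by apply/eqP/cmP=> p; rewrite cm1; apply/eqP/negPn/negP/m0.
    by rewrite -[mono _]/(1 : hecke_ring K) (rmorph1 f) (rmorph1 g).
  have mE : m = mmul (ucm p) (divcm m (ucm p)).
    apply/eqP/cmP=> q; rewrite cmM divcmE ucmE; case: eqVneq => [<-|_]; last by rewrite subn0.
    by rewrite subnKC // lt0n.
  have -> : mono m = hecke_symbol p * mono (divcm m (ucm p)).
    by rewrite malgM_def fgmulUU mulr1 -mE.
  apply: fgM; first exact: fg.
  by apply: IH; move: mk; rewrite {1}mE mdegM mdegU add1n ltnS.
have monz m (z : int) : << z *g m >> = mono m *~ z.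
  by rewrite -{1}[z]intz; apply: (raddfMz (@mkmalgU _ int m)).
move=> x; rewrite (monalgE x) (rmorph_sum f) (rmorph_sum g).
by apply: eq_bigr => m _; rewrite monz (raddfMz f) (raddfMz g); congr (_ *~ _); apply: mon.
Qed.

Lemma hecke_ring_act_symbol (a : {pred 'O_K}) (l : nat) (l_pr : prime l)
    (lam lamb : 'O_K) (E : coef_module l_pr lam lamb) p (c : 'M[K]_2 -> E) :
  hecke_ring_act a (hecke_symbol p) c = hecke a (val p) c.
Proof.
apply/funext=> g; rewrite /hecke_ring_act /hecke_monomial.
rewrite msuppU oner_eq0 big_seq_fset1 mcoeffUU.
have -> : finsupp (ucm p) = [:: p] :> seq (prime_elt K).
  by apply/perm_small_eq/uniq_perm; rewrite ?mdomU ?fset_uniq // => q; rewrite in_fset1 inE.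
by rewrite mulr1z /= cmUU.
Qed.
End HeckeRing.

(** A prime that is not coprime to l divides l, so that its norm divides l^2. *)
Lemma finitely_many_bad_primes (K : fieldExtType rat) (w : K) (D l : nat) :
  imaginary_generator w D -> class_number_one K -> prime l ->
  exists b : seq 'O_K, forall p, prime_element p -> ~ coprime_to_l l p -> p \in b.
Proof.
move=> genw cl1 l_pr; have [b bP] := finitely_many_bounded_norm genw (l ^ 2).
exists b => p [p0 _ p_prime] p_bad; apply: bP.
have [d [p' [l' [u [v [d0 pE lE uv]]]]]] :=
  bezout_class_number_one cl1 (or_introl (l%:R != 0) p0).
have [[z dE]|[z p'E]] : divides p d \/ divides p p'.
  by apply: p_prime; exists 1; rewrite mul1r -pE.
  have lzp : l%:R = z * l' * p by rewrite lE dE mulrAC.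
  have normE := integer_normM genw (z * l') p.
  rewrite -lzp integer_norm_nat // in normE.
  by apply: dvdn_leq; rewrite ?expn_gt0 ?prime_gt0 // normE dvdn_mull.
case: p_bad; exists (u * z), (v * z).
have p'0 : p' != 0 by apply: contra p0 => /eqP p'0; rewrite pE p'0 mulr0.
have zd : z * d = 1.
  by apply: (integer_mulfI p'0); rewrite mulr1 [RHS]p'E pE; ring.
have -> : p * (u * z) + l%:R * (v * z) = (p' * u + l' * v) * (z * d).
  by rewrite pE lE; ring.
by rewrite uv zd mulr1.
Qed.

Lemma occurs_realised (K : fieldExtType rat) (l : nat) (l_pr : prime l)
    (lam lamb : 'O_K) (a : {pred 'O_K}) (n : nat) (t : 'I_n -> 'M[K]_2)
    (E : coef_module l_pr lam lamb) (Phi : {rmorphism hecke_ring K -> 'F_l}) :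
  is_ideal a -> (forall i, good_matrix l (t i)) ->
  (forall A, good_matrix l A -> exists i, mx_mod_l l_pr A = mx_mod_l l_pr (t i)) ->
  occurs_in_H1 a E Phi ->
  exists chi W c B, realised a (translation_mx l_pr t) chi W c B /\
    forall p, chi (val p) = Phi (hecke_symbol p).
Proof.
move=> ideal_a t_good t_cover [c [cocy nontriv eig]].
pose chi p := if insub p is Some q then Phi (@hecke_symbol K q) else 0.
have chiE p : chi (val p) = Phi (hecke_symbol p) by rewrite /chi valK.
have actM A B : good_matrix l A -> good_matrix l B ->
    m2_act E (A *m B) = (m2_act E B \o m2_act E A)%VF.
  by move=> gA gB; apply: m2_actM; apply: (good_matrix_M2O l_pr).
have act_congr A B : good_matrix l A -> good_matrix l B ->
    mx_mod_l l_pr A = mx_mod_l l_pr B -> m2_act E A = m2_act E B.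
  move=> gA gB AB; rewrite !m2_act_mod_l ?AB //.
  - exact: (good_matrix_M2O l_pr).
  - exact: good_matrix_GL2.
  - exact: (good_matrix_M2O l_pr).
  - by rewrite -AB; exact: good_matrix_GL2.
have st0 : stable (l := l) (m2_act E) 0%VS.
  by move=> A x _; rewrite memv0 => /eqP->; rewrite linear0 mem0v.
have eig0 : eigenclass_mod a (m2_act E) 0%VS chi c.
  split=> //.
    move=> [e ce]; apply: nontriv; exists e => g /ce.
    by rewrite memv0 subr_eq0 => /eqP.
  move=> p [p_prime _].
  have pP : p \in @prime_pred K by apply/asboolP.
  have [e he] := eig (hecke_symbol (Sub p pP)); exists e => g gG.
  have := he g gG; rewrite hecke_ring_act_symbol -chiE /= => ->.
  by rewrite subrr mem0v.
have [W [c' [B R]]] := eigenclass_realised ideal_a (m2_act1 E) actM act_congr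
  t_good t_cover st0 eig0.
by exists chi, W, c', B.
Qed.

(** The code is a relation because it depends on the choice of a cocycle, of a
    coefficient module and of liftings. *)
Lemma finite_set_code (T : Type) (D : finType) (A : set T) (R : T -> D -> Prop) :
  (forall f, A f -> exists d, R f d) ->
  (forall f f' d, R f d -> R f' d -> f = f') -> finite_set A.
Proof.
move=> A_code code_inj.
apply: (@sub_finite_set _ _ (\bigcup_(d in [set: D]) [set f | R f d])%classic).
  by move=> f /A_code[d fd]; exists d.
apply: bigcup_finite => [|d _]; first exact: finite_finset.
have [[f fd]|/forallNP no_f] := pselect (exists f, R f d).
  by apply: sub_finite_set (finite_set1 f) => f' f'd; apply: code_inj f'd fd.
by apply: sub_finite_set (finite_set0 _) => f /no_f.
Qed.

Theorem corollary1p2 (K : fieldExtType rat) (l : nat) (l_pr : prime l)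
    (lam lamb : 'O_K) (a : {pred 'O_K}) :
  imaginary_quadratic K ->
  class_number_one K ->
  splits_as l lam lamb ->
  is_ideal a ->
  prime_to a l ->
  finite_set
    [set f : hecke_ring K -> 'F_l |
      exists (E : coef_module l_pr lam lamb)
             (Phi : {rmorphism hecke_ring K -> 'F_l}),
        occurs_in_H1 a E Phi /\ f = Phi]%classic.
Proof.
move=> imK cl1 _ ideal_a [x xa [y xy1]].
have [w [D genw]] := imaginary_quadratic_generator imK.
have x0 : x != 0.
  by apply: (coprime_to_l_neq0 l_pr); exists 1, y; rewrite mulr1.
have [s [s_Gamma s_gen]] := Gamma1_finitely_generated genw ideal_a cl1 (ex_intro2 _ _ x xa x0).
pose gen i := emb (tnth (in_tuple s) i).
have gen_Gamma i : gen i \in Gamma1 a by apply/Gamma1_emb/s_Gamma/mem_tnth.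
have gen_ind (P : 'M[K]_2 -> Prop) : P 1%:M ->
    (forall i g, g \in Gamma1 a -> P g -> P (gen i *m g)) ->
    forall g, g \in Gamma1 a -> P g.
  move=> P1 PM _ /Gamma1P[g -> /s_gen].
  suff: forall g, generated s g -> integral_Gamma1 a g /\ P (emb g).
    by move=> h /h[].
  move=> h; elim=> [|z k zs _ [kG Pk]].
    by rewrite emb1; split=> //; apply: integral_Gamma1_1.
  split; first by apply: integral_Gamma1M => //; apply: s_Gamma.
  have /tnthP[i ->] : z \in in_tuple s by [].
  by rewrite embM; apply: PM => //; apply/Gamma1_emb.
have [n [t [t_good t_cover]]] := good_matrix_representatives l_pr genw.
have [b bP] := finitely_many_bad_primes genw cl1 l_pr.
(* The eigenvalues at the finitely many primes of b are part of the code. *)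
pose D0 := (code_type l (size s) n * {ffun 'I_(size b) -> 'F_l})%type.
pose coded (f : hecke_ring K -> 'F_l) (d : D0) :=
  exists Phi : {rmorphism hecke_ring K -> 'F_l},
  f = Phi /\ exists chi W c B,
  [/\ realised a (translation_mx l_pr t) chi W c B, code gen W c B = d.1,
      [ffun i => chi (tnth (in_tuple b) i)] = d.2
    & forall p, chi (val p) = Phi (hecke_symbol p)].
apply: (finite_set_code (R := coded)) => [f|f f' d].
  move=> [E [Phi [occ ->]]].
  have [chi [W [c [B [R chiE]]]]] := occurs_realised ideal_a t_good t_cover occ.
  exists (code gen W c B, [ffun i => chi (tnth (in_tuple b) i)]), Phi.
  by split=> //; exists chi, W, c, B.
move=> [Phi [-> [chi [W [c [B [R codeE badE chiE]]]]]]].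
move=> [Phi' [-> [chi' [W' [c' [B' [R' codeE' badE' chiE']]]]]]].
apply/funext; apply: hecke_ring_morphism_eq => p; rewrite -chiE -chiE'.
have p_prime : prime_element (val p) by apply/asboolP/(valP p).
have [p_good|p_bad] := pselect (coprime_to_l l (val p)).
  apply: (code_determines l_pr ideal_a gen_Gamma gen_ind R R') => //.
  by rewrite codeE codeE'.
have /tnthP[i ->] : val p \in in_tuple b by apply: bP.
by have /ffunP/(_ i) := etrans badE (esym badE'); rewrite !ffunE.
Qed.
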